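(* (a) The symmetric tensor $A\in\mathrm{Sym}^d\mathbb{C}^{n+1}$ belongs to the singular space of $A$. (b) The dimension of the singular space of $A$ is $\binom{n+d}{d}-\binom{n+1}{2}$. (c) The eigentensors of $A$ are independent for a general $A$ (and then make a basis of the singular space) just in the cases $\mathrm{Sym}^d\mathbb{C}^2$, $\mathrm{Sym}^2\mathbb{C}^{n+1}$, $\mathrm{Sym}^3\mathbb{C}^3$.
   Context: $\mathrm{Sym}^d\mathbb{C}^{n+1}$ is the space of symmetric tensors in $(\mathbb{C}^{n+1})^{\otimes d}$, where $\mathbb{C}^{n+1}$ is identified with its dual through the standard symmetric bilinear form $\sum_i x_iy_i$. A symmetric tensor $A$ is identified with the homogeneous polynomial $A(x)=\sum A_{i_1\ldots i_d}x_{i_1}\cdots x_{i_d}$ of degree $d$ in $x_0,\ldots,x_n$. For $x\in\mathbb{C}^{n+1}$, $x^d=x\otimes\cdots\otimes x$. Eigentensors: the eigentensors of $A$ are the tensors $x^d$, with $0\neq x\in\mathbb{C}^{n+1}$ considered up to scalar, such that the vectors $\left(\frac{\partial A}{\partial x_0}(x),\ldots,\frac{\partial A}{\partial x_n}(x)\right)$ and $x$ are linearly dependent; equivalently, the contraction of $A$ with $x^{d-1}$ equals $\lambda x$ for some $\lambda\in\mathbb{C}$. Singular space: every homogeneous polynomial $g$ of degree $d$ in $x_0,\dots,x_n$ defines a unique linear functional $\ell_g$ on $\mathrm{Sym}^d\mathbb{C}^{n+1}$ with $\ell_g(x^d)=g(x)$ for all $x\in\mathbb{C}^{n+1}$. The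 singular space of $A$ is the linear subspace of $\mathrm{Sym}^d\mathbb{C}^{n+1}$ defined by the $\binom{n+1}{2}$ linear equations $\ell_{g_{ij}}=0$, $0\le i<j\le n$, where $g_{ij}=\frac{\partial A}{\partial x_j}x_i-\frac{\partial A}{\partial x_i}x_j$. Dimension means dimension as a complex vector space. ''General $A$'' means that the assertion holds for all $A$ in some nonempty Zariski open subset of $\mathrm{Sym}^d\mathbb{C}^{n+1}$.
   Formalization: Part (b) is stated for a general A and d ≥ 2 (it fails for A = 0, and for d = 1, n ≥ 2); part (c) is stated for n ≥ 1 and d ≥ 2 (for n = 0, or d = 1 and n ≥ 2, there is a single eigentensor, so the list of cases would be wrong). *)

(* Defs.v *)
From HB Require Import structures.
From mathcomp Require Import all_boot all_order all_fingroup all_algebra.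
From mathcomp Require Import mpoly.

Set Implicit Arguments.
Unset Strict Implicit.
Unset Printing Implicit Defensive.

Import Order.TTheory GRing.Theory Num.Theory.
Local Open Scope ring_scope.

(* Multi-indices i = (i_1, ..., i_d) with values in {0, ..., n}. *)
Notation midx n d := {ffun 'I_d -> 'I_n.+1}.

(* (F^{n+1})^{\otimes d}, in coordinates with respect to the basis
   e_{i_1} \otimes ... \otimes e_{i_d}. *)
Notation tensor F n d := {ffun midx n d -> F^o}.

Section Tensors.
Variables (F : numFieldType) (n d : nat).
Implicit Types (T G A : tensor F n d) (x y : 'rV[F]_n.+1).
Implicit Types (i : midx n d) (g : {mpoly F[n.+1]}).

Definition act_idx (s : 'S_d) i : midx n d := [ffun k => i (s k)].

Definition act_tensor (s : 'S_d) T : tensor F n d := [ffun i => T (act_idx s i)].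

Fact act_tensor_linear s : linear (act_tensor s).
Proof. by move=> a T G; apply/ffunP=> i; rewrite !ffunE. Qed.

HB.instance Definition _ s :=
  GRing.isLinear.Build F (tensor F n d) (tensor F n d) *:%R (act_tensor s)
    (act_tensor_linear s).

Definition Sym : {vspace tensor F n d} :=
  (\bigcap_(s : 'S_d) fixedSpace (linfun (act_tensor s)))%VS.

Lemma SymP T :
  reflect (forall (s : 'S_d) i, T (act_idx s i) = T i) (T \in Sym).
Proof.
apply: (iffP idP) => [TS s i | HT].
  move: TS; rewrite memvE => /subv_bigcapP/(_ s isT); rewrite -memvE.
  by move/fixedSpaceP; rewrite lfunE /= => /ffunP/(_ i); rewrite ffunE.
rewrite memvE; apply/subv_bigcapP => s _; rewrite -memvE.
by apply/fixedSpaceP; rewrite lfunE /=; apply/ffunP => i; rewrite ffunE HT.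
Qed.

Definition pow_tensor x : tensor F n d := [ffun i : midx n d => \prod_k x 0 (i k)].

(* The exponent of the monomial x_{i_1} ... x_{i_d}. *)
Definition mon i : 'X_{1..n.+1} := (\sum_k U_(i k))%MM.

Definition poly_of A : {mpoly F[n.+1]} := \sum_i (A i : F) *: 'X_[mon i].

(* Inverse of poly_of on forms of degree d: the coefficient of each monomial
   is shared equally among the multi-indices giving this monomial. *)
Definition tensor_of g : tensor F n d :=
  [ffun i => g@_(mon i) / #|[set j : midx n d | mon j == mon i]|%:R].

(* The bilinear form on tensors induced by \sum_i x_i y_i. *)
Definition pairing G T : F^o := \sum_i (G i : F) * (T i : F).

Fact pairing_linear G : linear (pairing G).
Proof.
move=> a T T'; rewrite /pairing scaler_sumr -big_split /=.
by apply: eq_bigr => i _; rewrite !ffunE mulrDr mulrCA.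
Qed.

HB.instance Definition _ G :=
  GRing.isLinear.Build F (tensor F n d) F^o *:%R (pairing G)
    (pairing_linear G).

(* The functional l_g of a form g of degree d; see ell_pow. *)
Definition ell g : 'Hom(tensor F n d, F^o) := linfun (pairing (tensor_of g)).

Fact mon_surj m : mdeg m = d -> exists i, mon i = m.
Proof.
rewrite /mon; elim: d m => [|e IH] m.
  move/eqP; rewrite mdeg_eq0 => /eqP ->.
  by exists [ffun=> ord0]; rewrite big_ord0.
move=> md; have m0 : m != 0%MM by rewrite -mdeg_eq0 md.
have /existsP[j mj] : [exists j, m j != 0%N].
  apply: contraR m0 => /existsPn H; apply/eqP/mnmP => j.
  by move/negPn/eqP: (H j) => ->; rewrite mnm0E.
have le_jm : (U_(j) <= m)%MM by rewrite lep1mP.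
have [|i Hi] := IH (m - U_(j))%MM.
  by apply: succn_inj; rewrite -md -{2}(submK le_jm) mdegD mdeg1 addn1.
exists [ffun k => if unlift ord0 k is Some k' then i k' else j].
rewrite big_ord_recl ffunE unlift_none.
under eq_bigr do rewrite ffunE liftK.
by rewrite Hi addmC submK.
Qed.

Lemma tensor_ofK g : g \is d.-homog -> poly_of (tensor_of g) = g.
Proof.
move=> /dhomogP gd; apply/mpolyP => m; rewrite raddf_sum /=.
under eq_bigr do rewrite mcoeffZ mcoeffX ffunE.
rewrite (bigID (fun i => mon i == m)) /= [X in _ + X]big1 ?addr0; last first.
  by move=> i /negPf ->; rewrite mulr0.
rewrite (eq_bigr (fun=> g@_m / #|[set j | mon j == m]|%:R)); last first.
  by move=> i /eqP ->; rewrite eqxx mulr1.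
rewrite -big_set sumr_const -cardsE.
have [/gd/mon_surj[i Hi]|/memN_msupp_eq0 ->] := boolP (m \in msupp g); last first.
  by rewrite mul0r mul0rn.
rewrite -[LHS]mulr_natr divfK // pnatr_eq0 -lt0n; apply/card_gt0P.
by exists i; rewrite !inE; apply/eqP.
Qed.

Lemma pairing_pow G x : pairing G (pow_tensor x) = (poly_of G).@[fun k => x 0 k].
Proof.
rewrite /pairing /poly_of raddf_sum /=; apply: eq_bigr => i _.
rewrite mevalZ ffunE /mon; congr (_ * _).
rewrite (big_morph _ (@mpolyXD _ _) (mpolyX0 _ _)) rmorph_prod /=.
by apply: eq_bigr => k _; rewrite mevalXU.
Qed.

Lemma ell_pow g x :
  g \is d.-homog -> ell g (pow_tensor x) = g.@[fun k => x 0 k].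
Proof. by move=> gd; rewrite lfunE /= pairing_pow tensor_ofK. Qed.

Definition partial_form A (i j : 'I_n.+1) : {mpoly F[n.+1]} :=
  mderiv j (poly_of A) * 'X_i - mderiv i (poly_of A) * 'X_j.

Definition singular_space A : {vspace tensor F n d} :=
  (Sym :&: \bigcap_(p : 'I_n.+1 * 'I_n.+1 | (p.1 < p.2)%N)
             lker (ell (partial_form A p.1 p.2)))%VS.

Definition gradient A x : 'rV[F]_n.+1 :=
  \row_i (mderiv i (poly_of A)).@[fun k => x 0 k].

(* x^d is an eigentensor of A, with x a representative of the point [x]. *)
Definition eigenvector A x : bool := (x != 0) && ~~ free [:: gradient A x; x].

(* For x, y != 0: [x] and [y] are different points of projective space. *)
Definition distinct_points x y : bool := free [:: x; y].

(* A may have infinitely many eigentensors, hence the quantification over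
   finite families. *)
Definition independent_eigentensors A : Prop :=
  forall xs : seq 'rV[F]_n.+1,
    all (eigenvector A) xs -> pairwise distinct_points xs ->
    free [seq pow_tensor x | x <- xs].

Definition eigentensors_basis A : Prop :=
  exists xs : seq 'rV[F]_n.+1,
    [/\ all (eigenvector A) xs,
        pairwise distinct_points xs,
        forall y, eigenvector A y -> has (fun x => ~~ distinct_points x y) xs
      & basis_of (singular_space A) [seq pow_tensor x | x <- xs]].

(* Polynomial functions on Sym are restrictions of polynomials in the tensor
   coordinates; an open set is the set of points where some member of a family
   S of polynomials does not vanish. *)
Definition zariski_open (U : tensor F n d -> Prop) : Prop :=
  exists S : {mpoly F[#|{: midx n d}|]} -> Prop,
    forall A, A \in Sym ->
      (U A <-> exists2 f, S f & f.@[fun k => A (enum_val k)] != 0).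

Definition for_general (P : tensor F n d -> Prop) : Prop :=
  exists U : tensor F n d -> Prop,
    [/\ zariski_open U,
        exists2 A, A \in Sym & U A
      & forall A, A \in Sym -> U A -> P A].

End Tensors.

Arguments Sym F n d : clear implicits.

(* Main.v *)
(* Contracting the first index of tensors turns the equations of the singular
   space of A into <A_j, T_i> = <A_i, T_j> for all i, j, where A_i and T_i are
   the slices of A and T; they are symmetric in A and T, whence (a), and (b) is
   the generic independence of these linear equations, checked on a weighted
   Fermat form A0 = sum_i a_i x_i^d.

   For (c), start from nondegenerate eigenvectors of A0. By Newton iteration
   they persist on every line A0 + t B for small t. Hence, if A0 has more
   of them than the dimension of the singular space, their powers are dependent
   for a Zariski dense set of A; for d >= 3 the Fermat form has
   sum_(k <= n) (d - 1)^k of them, which is too many except for n = 1 and for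
   (n, d) = (2, 3). In the remaining cases A0 has exactly as many eigenvectors
   as that dimension, with independent powers. Being first-order, the property
   of having such eigenvectors is, by quantifier elimination, generically
   constant, so that it holds for general A. A general A has no
   further eigenvectors, because the powers z^(d+1) of its eigenvectors lie in
   the space of symmetric tensors of order d + 1 whose slices are in the
   singular space, and for general A this space is no larger than for A0. *)

From HB Require Import structures.
From mathcomp Require Import all_boot all_order all_fingroup all_algebra.
From mathcomp Require Import separable cyclotomic closed_field mpoly complex reals.
From mathcomp Require boolp.
From mathcomp Require Import ring lra zify.
Require Import Defs.

Set Implicit Arguments.
Unset Strict Implicit.
Unset Printing Implicit Defensive.

Import Order.TTheory GRing.Theory Num.Theory.
Local Open Scope ring_scope.

(** * Slices and the equations of the singular space *)

Section Slices.
Variables (F : numFieldType) (n : nat).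

(** Independent powers y_k^d spanning a singular space of dimension N do not bound the number of
    eigenvectors: a further one, z, would merely give a linear relation between z^d and the y_k^d.
    This is why the argument passes to order d + 1. There at most N dimensions are available as
    well, so z^(d+1) and the y_k^(d+1) satisfy a relation. Its n + 1 slices are relations between
    z^d and the y_k^d whose coefficients carry the coordinates of the vectors, and comparing two of
    them forces z to be a multiple of some y_k. This replaces a count of eigenvectors by
    intersection theory, and, being a rank condition, it can be tested at one tensor. Existence of
    eigenvectors is of another kind: the iteration only reaches a neighbourhood of the Fermat form
    on each line, which yields Zariski density but no open set. Hence the detour through logic,
    where a dense condition that is generically true or generically false must be generically true.
    The iteration needs limits, whence complex numbers over a [realType]. *)

Definition icons d (j : 'I_n.+1) (r : midx n d) : midx n d.+1 :=
  [ffun k => if unlift ord0 k is Some k' then r k' else j].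

Definition itail d (i : midx n d.+1) : midx n d := [ffun k => i (lift ord0 k)].

Lemma icons0 d j (r : midx n d) : icons j r ord0 = j.
Proof. by rewrite ffunE unlift_none. Qed.

Lemma iconsS d j (r : midx n d) k : icons j r (lift ord0 k) = r k.
Proof. by rewrite ffunE liftK. Qed.

Lemma iconsK d (i : midx n d.+1) : icons (i ord0) (itail i) = i.
Proof.
by apply/ffunP => k; rewrite !ffunE; case: unliftP => [k' ->|->] //; rewrite ffunE.
Qed.

Lemma itailK d j (r : midx n d) : itail (icons j r) = r.
Proof. by apply/ffunP => k; rewrite ffunE iconsS. Qed.

Lemma big_icons d (V : nmodType) (f : midx n d.+1 -> V) :
  \sum_i f i = \sum_j \sum_r f (icons j r).
Proof.
rewrite pair_big /= (reindex (fun p : 'I_n.+1 * midx n d => icons p.1 p.2)) //=.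
exists (fun i : midx n d.+1 => (i ord0, itail i)) => [[j r] _|i _] /=; last exact: iconsK.
by rewrite icons0 itailK.
Qed.

Lemma mon_icons d j (r : midx n d) : mon (icons j r) = (U_(j) + mon r)%MM.
Proof.
rewrite /mon big_ord_recl icons0; congr (_ + _)%MM.
by apply: eq_bigr => k _; rewrite iconsS.
Qed.

Lemma prod_icons d (x : 'I_n.+1 -> F) j (r : midx n d) :
  \prod_k x (icons j r k) = x j * \prod_k x (r k).
Proof.
rewrite big_ord_recl icons0; congr (_ * _).
by apply: eq_bigr => k _; rewrite iconsS.
Qed.

Lemma monE d (i : midx n d) j : mon i j = count_mem j [tuple i k | k < d].
Proof.
rewrite /mon mnm_sumE -sum1_count big_tuple [RHS]big_mkcond /=.
by apply: eq_bigr => k _; rewrite mnmE tnth_mktuple; case: eqP.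
Qed.

(** Two words with the same letter counts differ by a permutation. So the orbits of ['S_d] are the
    fibres of [mon], and symmetry can be tested on exponents alone. *)
Lemma mon_perm d (i j : midx n d) : mon i = mon j -> exists s, act_idx s i = j.
Proof.
move=> e; have /tuple_permP[s es] : perm_eq [tuple j k | k < d] [tuple i k | k < d].
  by apply/allP => a _ /=; rewrite -!monE e.
exists s; apply/ffunP => k; rewrite ffunE.
have := congr1 (fun t => tnth t k) (val_inj es : [tuple j k | k < d] = _).
by rewrite !tnth_mktuple => ->.
Qed.

Lemma mon_act d s (i : midx n d) : mon (act_idx s i) = mon i.
Proof.
rewrite /mon [RHS](reindex_inj (@perm_inj _ s)).
by apply: eq_bigr => k _; rewrite ffunE.
Qed.

Lemma Sym_monP d (T : tensor F n d) :
  reflect (forall i j, mon i = mon j -> T i = T j) (T \in Sym F n d).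
Proof.
apply: (iffP (SymP _)) => [H i j /mon_perm[s <-]|H s i]; first by rewrite H.
by apply: H; rewrite mon_act.
Qed.

Definition slice d (T : tensor F n d.+1) j : tensor F n d :=
  [ffun r => T (icons j r)].

Lemma slice_Sym d (T : tensor F n d.+1) j :
  T \in Sym F n d.+1 -> slice T j \in Sym F n d.
Proof.
move=> /Sym_monP H; apply/Sym_monP => r r' e; rewrite !ffunE; apply: H.
by rewrite !mon_icons e.
Qed.

Lemma slice_comm d (T : tensor F n d.+2) j k :
  T \in Sym F n d.+2 -> slice (slice T j) k = slice (slice T k) j.
Proof.
move=> /Sym_monP H; apply/ffunP => r; rewrite !ffunE; apply: H.
by rewrite !mon_icons !addmA [(U_(j) + _)%MM]addmC.
Qed.

Lemma slice_pow d (x : 'rV[F]_n.+1) j :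
  slice (pow_tensor d.+1 x) j = x 0 j *: pow_tensor d x.
Proof.
by apply/ffunP => r; rewrite !ffunE (prod_icons (fun k => x 0 k)).
Qed.

Lemma pow_Sym d (x : 'rV[F]_n.+1) : pow_tensor d x \in Sym F n d.
Proof.
apply/SymP => s i; rewrite !ffunE [RHS](reindex_inj (@perm_inj _ s)) /=.
by apply: eq_bigr => k _; rewrite ffunE.
Qed.

Lemma pairingC d (G T : tensor F n d) : pairing G T = pairing T G.
Proof. by apply: eq_bigr => i _; rewrite mulrC. Qed.

Lemma pairingDl d (G G' T : tensor F n d) :
  pairing (G + G') T = pairing G T + pairing G' T.
Proof. by rewrite pairingC linearD /= !(pairingC T). Qed.

Lemma pairingZl d a (G T : tensor F n d) :
  pairing (a *: G) T = a * pairing G T.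
Proof. by rewrite pairingC linearZ /= (pairingC T). Qed.

Lemma pairingZr d a (G T : tensor F n d) :
  pairing G (a *: T) = a * pairing G T.
Proof. by rewrite pairingC pairingZl pairingC. Qed.

Lemma pairing_slice d (G T : tensor F n d.+1) :
  pairing G T = \sum_j pairing (slice G j) (slice T j).
Proof.
rewrite /pairing big_icons; apply: eq_bigr => j _.
by apply: eq_bigr => r _; rewrite !ffunE.
Qed.

Lemma poly_ofE d (A : tensor F n d.+1) :
  poly_of A = \sum_j 'X_j * poly_of (slice A j).
Proof.
rewrite /poly_of big_icons; apply: eq_bigr => j _; rewrite mulr_sumr.
by apply: eq_bigr => r _; rewrite ffunE mon_icons mpolyXD -scalerAr.
Qed.

Lemma mderivXU (i j : 'I_n.+1) : mderiv j ('X_i : {mpoly F[n.+1]}) = (i == j)%:R.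
Proof.
rewrite mderivX mnm1E; case: eqP => [->|_]; last by rewrite scale0r.
have -> : (U_(j) - U_(j) = 0 :> 'X_{1..n.+1})%MM.
  by apply/mnmP => k; rewrite mnmBE subnn mnm0E.
by rewrite mpolyX0 scale1r.
Qed.

(** Induction on the order: the product rule applied to sum_k X_k A_k yields A_j plus the sum of the
    X_k dA_k/dX_j. As slices of a symmetric tensor commute, the induction hypothesis turns that sum
    into a multiple of the expansion of A_j. *)
Lemma mderiv_poly_of d (A : tensor F n d.+1) j :
  A \in Sym F n d.+1 ->
  mderiv j (poly_of A) = d.+1%:R *: poly_of (slice A j).
Proof.
elim: d A j => [|d IH] A j AS; rewrite poly_ofE raddf_sum /=.
  have const k : mderiv j (poly_of (slice A k)) = 0.
    rewrite /poly_of raddf_sum /= big1 // => i _.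
    by rewrite /mon big_ord0 mderivZ mpolyX0 mderivC scaler0.
  under eq_bigr do rewrite mderivM mderivXU const mulr0 addr0.
  rewrite (bigD1 j) //= eqxx big1 ?addr0 ?mul1r ?scale1r //.
  by move=> k /negPf ->; rewrite mul0r.
under eq_bigr do rewrite mderivM mderivXU.
rewrite big_split /= (bigD1 j) //= eqxx big1 ?addr0; last first.
  by move=> k /negPf ->; rewrite mul0r.
rewrite mul1r mulrS scalerDl scale1r.
congr (_ + _); rewrite poly_ofE scaler_sumr; apply: eq_bigr => k _.
by rewrite IH ?slice_Sym // slice_comm // -scalerAr.
Qed.

(** [tensor_of] replaces G by its averages over the fibres of [mon], and a symmetric T, constant on
    the fibres, does not see the averaging. The formula thus covers nonsymmetric G, such as the
    tensor used for a product with ['X_i]. *)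
Lemma ell_poly_of d (G T : tensor F n d) :
  T \in Sym F n d -> ell d (poly_of G) T = pairing G T.
Proof.
move=> /Sym_monP TS; rewrite lfunE /= /pairing.
have coefE (i : midx n d) :
    (poly_of G)@_(mon i) = \sum_(j : midx n d | mon j == mon i) (G j : F).
  rewrite /poly_of raddf_sum /= [RHS]big_mkcond; apply: eq_bigr => j _.
  by rewrite mcoeffZ mcoeffX; case: eqP; rewrite (mulr1, mulr0).
under eq_bigr => i _ do rewrite ffunE coefE mulrAC mulr_suml mulr_suml.
rewrite (exchange_big_dep predT) //=; apply: eq_bigr => j _.
transitivity (\sum_(i : midx n d | mon j == mon i)
   (G j * T j / #|[set k : midx n d | mon k == mon j]|%:R)).
  by apply: eq_bigr => i /eqP e; rewrite -(TS _ _ e) e.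
rewrite sumr_const -[LHS]mulr_natr; set c := #|_|; set c' := #|_|.
have -> : c' = c.
  by apply: eq_card => k; rewrite inE; exact: eq_sym.
rewrite divfK // pnatr_eq0 -lt0n; apply/card_gt0P; exists j.
by rewrite !inE.
Qed.

Lemma poly_of0 d (G : tensor F n d) : G = 0 -> poly_of G = 0.
Proof. by move=> ->; rewrite /poly_of big1 // => i _; rewrite ffunE scale0r. Qed.

Lemma ell_X_poly_of d (G : tensor F n d) i (T : tensor F n d.+1) :
  T \in Sym F n d.+1 -> ell d.+1 (poly_of G * 'X_i) T = pairing G (slice T i).
Proof.
(* The tensor product of e_i and G, in general not symmetric, represents the product of the two
   polynomials. *)
move=> TS; pose H : tensor F n d.+1 :=
  [ffun k : midx n d.+1 => if k ord0 == i then G (itail k) else 0].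
have sH j : slice H j = if j == i then G else 0.
  by apply/ffunP => r; rewrite ffunE [LHS]ffunE icons0 itailK; case: ifP; rewrite ?ffunE.
have -> : poly_of G * 'X_i = poly_of H.
  rewrite poly_ofE (bigD1 i) //= big1 ?addr0.
    by rewrite sH eqxx mulrC.
  by move=> j /negPf ji; rewrite sH ji poly_of0 ?mulr0.
rewrite ell_poly_of // pairing_slice (bigD1 i) //= big1 ?addr0.
  by rewrite sH eqxx.
by move=> j /negPf ji; rewrite sH ji pairingC linear0.
Qed.

Lemma tensor_of_linear d : linear (@tensor_of F n d).
Proof.
move=> a g h; apply/ffunP => i.
by rewrite !ffunE mcoeffD mcoeffZ mulrDl -mulrA.
Qed.

Lemma ell_linear d a g h (T : tensor F n d) :
  ell d (a *: g + h) T = a * ell d g T + ell d h T.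
Proof. by rewrite !lfunE /= tensor_of_linear pairingDl pairingZl. Qed.

Lemma ell_partial_form d (A T : tensor F n d.+1) i j :
  A \in Sym F n d.+1 -> T \in Sym F n d.+1 ->
  ell d.+1 (partial_form A i j) T =
  d.+1%:R * (pairing (slice A j) (slice T i) - pairing (slice A i) (slice T j)).
Proof.
move=> AS TS; rewrite /partial_form !mderiv_poly_of // -!scalerAl.
rewrite -scalerBr -[X in ell _ X]addr0 ell_linear.
rewrite -[X in ell _ X]addrC -[X in X - _]mulr1 -scaleN1r ell_linear !mulr1.
rewrite !ell_X_poly_of //.
have -> : ell d.+1 0 T = 0.
  by rewrite -(poly_of0 (erefl (0 : tensor F n d.+1))) ell_poly_of // pairingC linear0.
by rewrite addr0 mulN1r addrC.
Qed.

Definition singular_eqs d (A T : tensor F n d.+1) : Prop :=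
  forall i j, pairing (slice A j) (slice T i) = pairing (slice A i) (slice T j).

Lemma singularP d (A T : tensor F n d.+1) : A \in Sym F n d.+1 ->
  (T \in singular_space A) <-> T \in Sym F n d.+1 /\ singular_eqs A T.
Proof.
move=> AS; rewrite memv_cap; split=> [/andP[TS]|[TS TE]].
  rewrite memvE => /subv_bigcapP TK; split=> // i j.
  wlog ij : i j / (i < j)%N.
    case: (ltngtP i j) => [ij|ij|/val_inj ->] // H; first exact: H.
    exact/esym/H.
  have := TK (i, j) ij; rewrite -memvE memv_ker /= ell_partial_form //.
  by rewrite mulf_eq0 pnatr_eq0 /= subr_eq0 => /eqP.
rewrite TS /= memvE; apply/subv_bigcapP => -[i j] /= _.
by rewrite -memvE memv_ker ell_partial_form // TE subrr mulr0.
Qed.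

Lemma singular_refl d (A : tensor F n d.+1) :
  A \in Sym F n d.+1 -> A \in singular_space A.
Proof. by move=> AS; apply/singularP => //; split=> // i j; rewrite pairingC. Qed.

End Slices.

(** * Eigenvectors as solutions of polynomial equations *)

Section Eigen.
Variables (F : numFieldType) (n : nat).

Lemma free2P (u x : 'rV[F]_n.+1) : x != 0 ->
  (~~ free [:: u; x]) <-> exists k, u = k *: x.
Proof.
move=> x0; rewrite free_cons span_seq1 seq1_free x0 andbT negbK.
by split=> [/vlineP|uk]; last exact/vlineP.
Qed.

Lemma proportionalP (u x : 'rV[F]_n.+1) : x != 0 ->
  (exists k, u = k *: x) <-> forall i j, u 0 j * x 0 i = u 0 i * x 0 j.
Proof.
move=> x0; split=> [[k ->] i j|H]; first by rewrite !mxE mulrAC.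
have /rV0Pn[c xc] := x0.
exists (u 0 c / x 0 c); apply/rowP => j; apply: (mulIf xc).
by rewrite H !mxE mulrAC divfK.
Qed.

(** The 2 x 2 minors of the contraction of A and x: equations without an eigenvalue, fit for
    elimination. They also hold at x = 0, so nonvanishing is always required separately. *)
Definition eigen_eqs d (A : tensor F n d.+1) (x : 'rV[F]_n.+1) : Prop :=
  forall i j, pairing (slice A j) (pow_tensor d x) * x 0 i =
              pairing (slice A i) (pow_tensor d x) * x 0 j.

Lemma gradientE d (A : tensor F n d.+1) x i : A \in Sym F n d.+1 ->
  gradient A x 0 i = d.+1%:R * pairing (slice A i) (pow_tensor d x).
Proof. by move=> AS; rewrite mxE mderiv_poly_of // mevalZ pairing_pow. Qed.

Lemma eigenvectorP d (A : tensor F n d.+1) x : A \in Sym F n d.+1 ->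
  eigenvector A x <-> x != 0 /\ eigen_eqs A x.
Proof.
move=> AS; rewrite /eigenvector; case: eqP => [|/eqP] x0 /=.
  by split=> // -[].
rewrite free2P // proportionalP //; split=> [H|[_ H] i j].
  split=> // i j; have := H i j; rewrite !gradientE // -!mulrA.
  by move/(mulfI _); apply; rewrite pnatr_eq0.
by rewrite !gradientE // -!mulrA H.
Qed.

Lemma singular_pow d (A : tensor F n d.+1) x : A \in Sym F n d.+1 ->
  eigenvector A x -> pow_tensor d.+1 x \in singular_space A.
Proof.
move=> AS /(eigenvectorP _ AS)[_ Ax]; apply/singularP => //.
split; first exact: pow_Sym.
by move=> i j; rewrite !slice_pow !pairingZr mulrC Ax mulrC.
Qed.

End Eigen.

(** * Fermat tensors *)

Section Fermat.
Variables (F : numFieldType) (n : nat).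

Definition cidx d (j : 'I_n.+1) : midx n d := [ffun=> j].

Definition fermat d (a : 'I_n.+1 -> F) : tensor F n d :=
  \sum_k a k *: pow_tensor d (delta_mx 0 k).

Lemma fermat_Sym d a : fermat d a \in Sym F n d.
Proof. by apply: memv_suml => k _; apply/memvZ/pow_Sym. Qed.

Lemma slice_fermat d a j :
  slice (fermat d.+1 a) j = a j *: pow_tensor d (delta_mx 0 j).
Proof.
have -> : slice (fermat d.+1 a) j = \sum_k slice (a k *: pow_tensor d.+1 (delta_mx 0 k)) j.
  by apply/ffunP => r; rewrite ffunE /fermat !sum_ffunE; apply: eq_bigr => k _; rewrite [RHS]ffunE.
have sE k : slice (a k *: pow_tensor d.+1 (delta_mx 0 k)) j =
    (a k * (j == k)%:R) *: pow_tensor d (delta_mx 0 k).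
  rewrite -scalerA -[_%:R *: _]/(_%:R *: _).
  have -> : (j == k)%:R = (delta_mx 0 k : 'rV[F]_n.+1) 0 j by rewrite mxE eqxx.
  by rewrite -slice_pow; apply/ffunP => r; rewrite !ffunE.
under eq_bigr do rewrite sE.
rewrite (bigD1 j) //= eqxx mulr1 big1 ?addr0 // => k /negPf kj.
by rewrite eq_sym kj mulr0 scale0r.
Qed.

Lemma pairing_slice_fermat d a j (T : tensor F n d) :
  pairing (slice (fermat d.+1 a) j) T = a j * T (cidx d j).
Proof.
rewrite slice_fermat pairingZl; congr (_ * _).
rewrite /pairing (bigD1 (cidx d j)) //= big1 ?addr0 => [|i ij].
  rewrite ffunE big1 ?mul1r // => k _.
  by rewrite mxE ffunE !eqxx.
have /existsP[k ik] : [exists k, i k != j].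
  apply: contraR ij => /existsPn H; apply/eqP/ffunP => k; rewrite ffunE.
  exact/eqP/negPn/H.
by rewrite ffunE (bigD1 k) //= mxE eqxx (negPf ik) !mul0r.
Qed.

(** What makes Fermat tensors good test points: each equation involves only two coordinates of T,
    those of the monomials x_i x_j^d and x_j x_i^d. *)
Lemma fermat_singular_eqs d a (T : tensor F n d.+1) :
  singular_eqs (fermat d.+1 a) T <->
  forall i j, a j * T (icons i (cidx d j)) = a i * T (icons j (cidx d i)).
Proof.
by split=> H i j; have := H i j; rewrite !pairing_slice_fermat !ffunE.
Qed.

Lemma pow_cidx d (x : 'rV[F]_n.+1) j : pow_tensor d x (cidx d j) = x 0 j ^+ d.
Proof.
rewrite ffunE; under eq_bigr do rewrite ffunE.
by rewrite prodr_const card_ord.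
Qed.

Lemma mon_cidx d j : mon (cidx d j) = (U_(j) *+ d)%MM.
Proof.
rewrite /mon; under eq_bigr do rewrite ffunE.
apply/mnmP => k; rewrite mnm_sumE mulmnE sum_nat_const card_ord mulnC //.
Qed.

(** The exponents 1 and d + 1 tell the two variables apart unless d = 0. This exception is why
    quadrics need distinct weights. *)
Lemma mon_icons_cidx d (i j k l : 'I_n.+1) : i != j -> k != l ->
  mon (icons k (cidx d.+1 l)) = mon (icons i (cidx d.+1 j)) ->
  k = i /\ l = j \/ [/\ d = 0%N, k = j & l = i].
Proof.
move=> ij kl /mnmP e.
have {}e c : ((k == c) + (l == c) * d.+1 = (i == c) + (j == c) * d.+1)%N.
  by have := e c; rewrite !mon_icons !mon_cidx !mnmDE !mulmnE !mnm1E.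
have lk : (l == k) = false by rewrite eq_sym (negPf kl).
have := e l; have := e k; rewrite !eqxx (negPf kl) lk.
case: (j =P l) => [->|jl].
  by rewrite lk; case: (i =P k) => [->|_ //]; left.
case: (i =P l) => [il|//]; case: (j =P k) => [-> _|_]; last first.
  by rewrite il lk.
by rewrite !mul0n !mul1n => -[d0]; right; rewrite il d0.
Qed.

End Fermat.

(** * The dimension of the space of symmetric tensors *)

Section SymDim.
Variables (F : numFieldType) (n d : nat).

Local Notation sorted_tuples :=
  [set t : d.-tuple 'I_n.+1 | sorted leq [seq val i | i <- t]].

Definition rep (t : d.-tuple 'I_n.+1) : midx n d := [ffun k => tnth t k].

Lemma mon_rep (t : d.-tuple 'I_n.+1) c : mon (rep t) c = count_mem c t.
Proof.
rewrite monE; congr (count _ (val (_ : d.-tuple _))); apply: eq_from_tnth => k.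
by rewrite tnth_mktuple ffunE.
Qed.

Lemma mon_rep_surj (i : midx n d) : exists2 t, t \in sorted_tuples & mon (rep t) = mon i.
Proof.
pose s := sort (fun a b : 'I_n.+1 => (a <= b)%N) [tuple i k | k < d].
have ss : size s == d by rewrite size_sort size_tuple.
exists (Tuple ss).
  rewrite inE /= sorted_map; apply: sort_sorted => a b; exact: leq_total.
apply/mnmP => c; rewrite mon_rep monE /=.
by move/seq.permP: (permEl (perm_sort (fun a b : 'I_n.+1 => (a <= b)%N) [tuple i k | k < d])).
Qed.

Lemma mon_rep_inj : {in sorted_tuples &, injective (fun t => mon (rep t))}.
Proof.
move=> t u; rewrite !inE /= !sorted_map => ts us e; apply: val_inj => /=.
apply: (sorted_eq _ _ ts us).
- by move=> a b c /=; apply: leq_trans.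
- by move=> a b /= ab; apply/val_inj/anti_leq.
by apply/allP => c _ /=; rewrite -!mon_rep e.
Qed.

Definition mon_tensor (i : midx n d) : tensor F n d :=
  [ffun j => (mon j == mon i)%:R].

Lemma mon_tensor_Sym i : mon_tensor i \in Sym F n d.
Proof. by apply/Sym_monP => j k e; rewrite !ffunE e. Qed.

Definition Sym_seq : seq (tensor F n d) :=
  [seq mon_tensor (rep t) | t <- enum sorted_tuples].

Lemma sum_mon_tensor (c : d.-tuple 'I_n.+1 -> F) u : u \in sorted_tuples ->
  (\sum_(t in sorted_tuples) c t *: mon_tensor (rep t)) (rep u) = c u.
Proof.
move=> us; rewrite sum_ffunE (bigD1 u) //= !ffunE eqxx.
rewrite big1 ?addr0 => [|t /andP[ts tu]]; first exact: mulr1.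
rewrite !ffunE; case: eqP => [e|_]; last exact: mulr0.
by rewrite (mon_rep_inj us ts e) eqxx in tu.
Qed.

(** Each orbit of multi-indices has exactly one sorted representative, so the indicators of the
    orbits are dual to evaluation at sorted tuples. *)
Lemma Sym_basis : basis_of (Sym F n d) Sym_seq.
Proof.
apply/andP; split.
  apply/eqP/vspaceP => T; apply/idP/idP => [|TS].
    apply: (subvP _ T); apply/span_subvP => _ /mapP[t _ ->].
    exact: mon_tensor_Sym.
  have -> : T = \sum_(t in sorted_tuples) (T (rep t) : F) *: mon_tensor (rep t).
    apply/ffunP => i; have [u us eu] := mon_rep_surj i.
    have /Sym_monP H : \sum_(t in sorted_tuples) (T (rep t) : F) *: mon_tensor (rep t) \in Sym F n d.
      by apply: memv_suml => t _; apply/memvZ/mon_tensor_Sym.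
    by rewrite -(H _ _ eu) sum_mon_tensor //; move/Sym_monP: TS; apply; exact/esym.
  apply: memv_suml => t ts; apply: memvZ; apply: memv_span.
  by apply: map_f; rewrite mem_enum.
rewrite /Sym_seq; set s := enum _.
have us : uniq s by apply: enum_uniq.
apply/(@freeP _ _ _ (map_tuple (fun t => mon_tensor (rep t)) (in_tuple s))) => k H i.
pose c t := \sum_(j < size s | tnth (in_tuple s) j == t) k j.
have kc j : c (tnth (in_tuple s) j) = k j.
  rewrite /c (bigD1 j) //= big1 ?addr0 // => l /andP[/eqP e].
  move/(tuple_uniqP (in_tuple s)): us => inj.
  by rewrite (inj _ _ e) eqxx.
have ms j : tnth (in_tuple s) j \in sorted_tuples by rewrite -mem_enum mem_tnth.
rewrite -kc -(sum_mon_tensor c (ms i)).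
rewrite -big_enum /= -/s (big_tnth _ _ s) /=.
transitivity ((0 : tensor F n d) (rep (tnth (in_tuple s) i))); last by rewrite ffunE.
congr (fun_of_fin _ _); rewrite -[RHS]H; apply: eq_bigr => j _.
by rewrite kc (nth_map [tuple of nseq d ord0]) // (tnth_nth [tuple of nseq d ord0]).
Qed.

Lemma dim_Sym : \dim (Sym F n d) = 'C(n + d, d).
Proof.
have /andP[/eqP <- /eqP ->] := Sym_basis.
by rewrite size_map -cardE addnC; exact: card_sorted_tuples.
Qed.

End SymDim.

(** * Generic properties *)

Section Generic.
Variables (F : numFieldType) (n d : nat).
Local Notation T := (tensor F n d).

Definition polyfun (phi : T -> F) : Prop :=
  exists f : {mpoly F[#|{: midx n d}|]},
    forall A : T, f.@[fun k => A (enum_val k)] = phi A.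

Lemma polyfun_ext phi psi : phi =1 psi -> polyfun phi -> polyfun psi.
Proof. by move=> e [f H]; exists f => A; rewrite H e. Qed.

Lemma polyfun_const c : polyfun (fun=> c).
Proof. by exists c%:MP => A; rewrite mevalC. Qed.

Lemma polyfun_coord i : polyfun (fun A => A i : F).
Proof. by exists 'X_(enum_rank i) => A; rewrite mevalXU enum_rankK. Qed.

Lemma polyfunD phi psi :
  polyfun phi -> polyfun psi -> polyfun (fun A => phi A + psi A).
Proof. by move=> [f Hf] [g Hg]; exists (f + g) => A; rewrite mevalD Hf Hg. Qed.

Lemma polyfunM phi psi :
  polyfun phi -> polyfun psi -> polyfun (fun A => phi A * psi A).
Proof. by move=> [f Hf] [g Hg]; exists (f * g) => A; rewrite mevalM Hf Hg. Qed.

Lemma polyfunB phi psi :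
  polyfun phi -> polyfun psi -> polyfun (fun A => phi A - psi A).
Proof. by move=> [f Hf] [g Hg]; exists (f - g) => A; rewrite mevalB Hf Hg. Qed.

Lemma polyfun_sum (I : Type) (r : seq I) (P : pred I) (phi : I -> T -> F) :
  (forall i, polyfun (phi i)) -> polyfun (fun A => \sum_(i <- r | P i) phi i A).
Proof.
move=> H; elim: r => [|i r IH].
  by apply: polyfun_ext (polyfun_const 0) => A; rewrite big_nil.
case Pi: (P i).
  by apply: polyfun_ext (polyfunD (H i) IH) => A; rewrite big_cons Pi.
by apply: polyfun_ext IH => A; rewrite big_cons Pi.
Qed.

Lemma polyfun_prod (I : Type) (r : seq I) (P : pred I) (phi : I -> T -> F) :
  (forall i, polyfun (phi i)) -> polyfun (fun A => \prod_(i <- r | P i) phi i A).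
Proof.
move=> H; elim: r => [|i r IH].
  by apply: polyfun_ext (polyfun_const 1) => A; rewrite big_nil.
case Pi: (P i).
  by apply: polyfun_ext (polyfunM (H i) IH) => A; rewrite big_cons Pi.
by apply: polyfun_ext IH => A; rewrite big_cons Pi.
Qed.

Lemma polyfun_det p (M : T -> 'M[F]_p) :
  (forall i j, polyfun (fun A => M A i j)) -> polyfun (fun A => \det (M A)).
Proof.
move=> H; apply: polyfun_sum => s; apply: polyfunM; first exact: polyfun_const.
by apply: polyfun_prod => i.
Qed.

Definition generic (Q : T -> Prop) : Prop :=
  exists phi, [/\ polyfun phi, exists2 A, A \in Sym F n d & phi A != 0
    & forall A, A \in Sym F n d -> phi A != 0 -> Q A].

(** A nonempty open set contains a nonempty principal one, given by a member of the family that does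
    not vanish somewhere on [Sym]. Hence one polynomial suffices. *)
Lemma for_generalP (Q : T -> Prop) : for_general Q <-> generic Q.
Proof.
split=> [[U [[S US] [A AS UA] H]]|[phi [[f Hf] [A AS fA] H]]].
  have /US [//|f Sf fA] := UA.
  exists (fun A : T => f.@[fun k => A (enum_val k)]); split; first by exists f.
    by exists A.
  by move=> B BS fB; apply: H => //; apply/US => //; exists f.
exists (fun A => phi A != 0); split => //; last by exists A.
exists (fun g => g = f) => B BS; split=> [fB|[g -> ]].
  by exists f => //; rewrite Hf.
by rewrite Hf.
Qed.

Lemma genericW (Q Q' : T -> Prop) :
  (forall A, A \in Sym F n d -> Q A -> Q' A) -> generic Q -> generic Q'.
Proof.
move=> QQ [phi [pf A0 H]]; exists phi; split=> // A AS fA.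
exact/QQ/H.
Qed.

(** The line passes through A at t = 0 and through B at t = 1. *)
Lemma polyfun_line phi (A B : T) : polyfun phi ->
  exists p : {poly F}, forall t, p.[t] = phi (A + t *: (B - A)).
Proof.
move=> [f Hf].
pose l (k : 'I_#|{: midx n d}|) : {poly F} := (A (enum_val k) : F)%:P + ((B - A) (enum_val k) : F) *: 'X.
exists (\sum_(m <- msupp f) (f@_m)%:P * \prod_i l i ^+ m i) => t.
rewrite -Hf mevalE horner_sum; apply: eq_bigr => m _.
rewrite hornerM hornerC horner_prod; congr (_ * _); apply: eq_bigr => k _.
by rewrite horner_exp hornerD hornerC hornerZ hornerX !ffunE mulrC.
Qed.

Lemma poly_nonroot (p : {poly F}) (s : nat -> F) :
  p != 0 -> injective s -> exists k, p.[s k] != 0.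
Proof.
move=> p0 inj; have := @max_poly_roots _ p (mkseq s (size p)) p0.
rewrite mkseq_uniq // size_mkseq ltnn.
case: allP => [_ /(_ isT isT) //|H _].
have : has (fun x => ~~ root p x) (mkseq s (size p)) by rewrite has_predC; apply/negP => /allP.
by case/hasP => _ /mapP[k _ ->] pk; exists k.
Qed.

Lemma mulIrn_inj : injective (fun k => k%:R : F).
Proof. by move=> a b /eqP; rewrite eqr_nat => /eqP. Qed.

Lemma poly_nonzero_at (p : {poly F}) t : p.[t] != 0 -> p != 0.
Proof. by apply: contraNneq => ->; rewrite horner0. Qed.

(** Irreducibility of the linear space [Sym]: on the line through A and B both functions become
    nonzero polynomials in t, and their product has a natural number as a non-root. *)
Lemma polyfun_common phi psi A B : polyfun phi -> polyfun psi ->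
    A \in Sym F n d -> B \in Sym F n d -> phi A != 0 -> psi B != 0 ->
  exists2 C, C \in Sym F n d & phi C * psi C != 0.
Proof.
move=> pf pg AS BS fA gB.
have [p Hp] := polyfun_line A B pf; have [q Hq] := polyfun_line A B pg.
have p0 : p != 0 by apply: (@poly_nonzero_at _ 0); rewrite Hp scale0r addr0.
have q0 : q != 0 by apply: (@poly_nonzero_at _ 1); rewrite Hq scale1r addrC subrK.
have [k] := poly_nonroot (mulf_neq0 p0 q0) mulIrn_inj.
rewrite hornerM Hp Hq => H; exists (A + k%:R *: (B - A)) => //.
by rewrite memvD // memvZ // memvB.
Qed.

Lemma genericI (Q Q' : T -> Prop) :
  generic Q -> generic Q' -> generic (fun A => Q A /\ Q' A).
Proof.
move=> [phi [pf [A AS fA] H]] [psi [pg [B BS gB] H']].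
have [C CS fgC] := polyfun_common pf pg AS BS fA gB.
exists (fun A => phi A * psi A); split; [exact: polyfunM|by exists C|].
by move=> D DS; rewrite mulf_eq0 negb_or => /andP[/H ? /H' ?]; split; auto.
Qed.

(** With a right inverse B of K A0 kept fixed, the determinant of K A times B is polynomial in A and
    equals 1 at A0. *)
Lemma generic_row_free p q (K : T -> 'M[F]_(p, q)) A0 :
    (forall i j, polyfun (fun A => K A i j)) -> A0 \in Sym F n d ->
  row_free (K A0) -> generic (fun A => row_free (K A)).
Proof.
move=> pK AS /row_freeP[B KB]; exists (fun A => \det (K A *m B)); split.
- apply: polyfun_det => i j.
  apply: (@polyfun_ext (fun A => \sum_k K A i k * B k j)) => [A|]; first by rewrite mxE.
  by apply: polyfun_sum => k; apply: polyfunM => //; exact: polyfun_const.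
- by exists A0 => //; rewrite KB det1 oner_neq0.
move=> A _; rewrite -unitfE -unitmxE => u.
by apply/row_freeP; exists (B *m invmx (K A *m B)); rewrite mulmxA mulmxV.
Qed.

End Generic.

(** * The dimension of the singular space *)

Section SingularDim.
Variables (F : numFieldType) (n d : nat).
Local Notation T := (tensor F n d.+1).

Definition singular_form (A S : T) (p : 'I_n.+1 * 'I_n.+1) : F :=
  pairing (slice A p.2) (slice S p.1) - pairing (slice A p.1) (slice S p.2).

Lemma polyfun_singular_form S p : polyfun (fun A => singular_form A S p).
Proof.
have pl j k : polyfun (fun A : T => pairing (slice A j) (slice S k)).
  apply: polyfun_sum => r; apply: polyfunM; last exact: polyfun_const.
  by apply: (@polyfun_ext F n d.+1 _ _ _ (polyfun_coord F (icons j r))) => A; rewrite ffunE.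
exact: polyfunB.
Qed.

Lemma singular_form_linear A a (S S' : T) p :
  singular_form A (a *: S + S') p = a * singular_form A S p + singular_form A S' p.
Proof.
have sl j : slice (a *: S + S') j = a *: slice S j + slice S' j.
  by apply/ffunP => r; rewrite !ffunE.
rewrite /singular_form !sl !(pairingC (slice A _)) !pairingDl !pairingZl; ring.
Qed.

Lemma singular_eqs_form (A S : T) : singular_eqs A S <->
  forall p : 'I_n.+1 * 'I_n.+1, (p.1 < p.2)%N -> singular_form A S p = 0.
Proof.
split=> [H p _|H i j]; first by rewrite /singular_form H subrr.
wlog ij : i j / (i < j)%N.
  case: (ltngtP i j) => [ij|ij|/val_inj ->] // W; first exact: W.
  exact/esym/W.
exact/subr0_eq/(H (i, j)).
Qed.

End SingularDim.

Section SingularDimension.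
Variables (F : numFieldType) (n : nat).

Local Notation pairs := [set p : 'I_n.+1 * 'I_n.+1 | (p.1 < p.2)%N].
Local Notation npairs := #|pairs|.

Lemma card_pairs : npairs = 'C(n.+1, 2).
Proof.
rewrite -bin2_sum big_mkord -sum1dep_card.
rewrite -(pair_big_dep predT (fun i j : 'I_n.+1 => (i < j)%N) (fun _ _ => 1%N)) /=.
rewrite (exchange_big_dep predT) //=; apply: eq_bigr => j _.
rewrite sum1dep_card -[RHS](card_ord j).
have le_jn : (j <= n.+1)%N by apply: ltnW.
have inj : injective (widen_ord le_jn) by move=> a b /(congr1 val) /= /val_inj.
rewrite -(card_imset predT inj).
apply: eq_card => i; rewrite inE; apply/idP/imsetP => [ij|[k _ ->]] //=.
by exists (Ordinal ij) => //; apply: val_inj.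
Qed.

Section Fixed.
Variables (d : nat) (A : tensor F n d.+1).

Definition singular_map (S : tensor F n d.+1) : 'rV[F]_npairs :=
  \row_b singular_form A S (enum_val b).

Fact singular_map_linear : linear singular_map.
Proof. by move=> a S S'; apply/rowP => b; rewrite !mxE singular_form_linear. Qed.

HB.instance Definition _ :=
  GRing.isLinear.Build F (tensor F n d.+1) 'rV[F]_npairs *:%R singular_map
    singular_map_linear.

Lemma singular_spaceE : A \in Sym F n d.+1 ->
  singular_space A = (Sym F n d.+1 :&: lker (linfun singular_map))%VS.
Proof.
move=> AS; apply/vspaceP => S; rewrite memv_cap memv_ker lfunE /=.
apply/idP/andP => [/(singularP _ AS)[SS /singular_eqs_form H]|[SS /eqP H]].
  split=> //; apply/eqP/rowP => b; rewrite !mxE; apply: H.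
  by have := enum_valP b; rewrite inE.
apply/singularP => //; split=> //; apply/singular_eqs_form => p pp.
have ps : p \in pairs by rewrite inE.
by have /rowP/(_ (enum_rank_in ps p)) := H; rewrite !mxE enum_rankK_in.
Qed.

(** There are as many test tensors as equations, so the matrix is square. Its invertibility makes
    the system of equations surjective on [Sym], and rank-nullity gives the dimension. *)
Lemma dim_singular_space (t : 'I_npairs -> tensor F n d.+1) :
    A \in Sym F n d.+1 -> (forall a, t a \in Sym F n d.+1) ->
    row_free (\matrix_(a < npairs, b < npairs) singular_form A (t a) (enum_val b)) ->
  \dim (singular_space A) = ('C(n + d.+1, d.+1) - 'C(n.+1, 2))%N.
Proof.
set M := \matrix_(a, b) _ => AS tS free_M.
have := limg_ker_dim (linfun singular_map) (Sym F n d.+1).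
rewrite -singular_spaceE // dim_Sym => <-.
suff -> : (linfun singular_map @: Sym F n d.+1)%VS = fullv.
  by rewrite dimvf /dim /= mul1n card_pairs addnK.
apply/eqP; rewrite eqEsubv subvf /=; apply/subvP => v _.
have /row_fullP[B BM] : row_full M by rewrite row_full_unit -row_free_unit.
apply/memv_imgP; exists (\sum_a (v *m B) 0 a *: t a).
  by apply: memv_suml => a _; apply/memvZ/tS.
rewrite lfunE /= linear_sum /= -[LHS]mulmx1 -BM mulmxA mulmx_sum_row.
apply: eq_bigr => a _; rewrite linearZ /=; congr (_ *: _).
by apply/rowP => b; rewrite !mxE.
Qed.

End Fixed.

Section GenericDim.
Variable e : nat.
Local Notation d := e.+2.

(** At the Fermat form, tested on the monomials x_i x_j^(d-1) with i < j, the matrix of the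
    equations is diagonal. Its entries are a_j, or a_j - a_i for quadrics, where x_i x_j occurs on
    both sides of an equation; the hypotheses on the weights say that these are nonzero. *)
Lemma generic_dim_singular (a : 'I_n.+1 -> F) :
    (forall i, a i != 0) -> (forall i j, i != j -> e = 0%N -> a i != a j) ->
  generic (fun A : tensor F n d =>
    \dim (singular_space A) = ('C(n + d, d) - 'C(n.+1, 2))%N).
Proof.
move=> a0 a_inj.
pose q (b : 'I_npairs) : 'I_n.+1 * 'I_n.+1 := enum_val b.
have q_lt b : ((q b).1 < (q b).2)%N by have := enum_valP b; rewrite inE.
have q_neq b : (q b).1 != (q b).2 by rewrite neq_ltn q_lt.
have q_inj b c : (q b).1 = (q c).1 -> (q b).2 = (q c).2 -> b = c.
  move=> e1 e2; apply: enum_val_inj; rewrite -/(q b) -/(q c).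
  by move: e1 e2; case: (q b) => ? ?; case: (q c) => ? ? /= -> ->.
pose idx b : midx n d := icons (q b).1 (cidx e.+1 (q b).2).
pose t b : tensor F n d := mon_tensor F (idx b).
pose M A := \matrix_(b < npairs, c < npairs) singular_form A (t b) (q c).
suff gM : generic (fun A : tensor F n d => row_free (M A)).
  apply: genericW gM => A AS; apply: dim_singular_space => // b.
  exact: mon_tensor_Sym.
apply: (@generic_row_free _ _ _ _ _ M (fermat d a)).
- move=> b c; apply: polyfun_ext (polyfun_singular_form (t b) (q c)) => A.
  by rewrite mxE.
- exact: fermat_Sym.
pose D := \row_(b < npairs) (a (q b).2 - (e == 0%N)%:R * a (q b).1).
have D0 b : D 0 b != 0.
  rewrite mxE; case: (e =P 0%N) => e0 /=; rewrite ?mul1r ?mul0r ?subr0 //.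
  by rewrite subr_eq0 a_inj // eq_sym.
have -> : M (fermat d a) = diag_mx D.
  apply/matrixP => b c; rewrite !mxE /singular_form !pairing_slice_fermat !ffunE.
  have m1 : (mon (icons (q c).1 (cidx e.+1 (q c).2)) == mon (idx b)) = (b == c).
    apply/eqP/eqP => [/mon_icons_cidx[]|->] // [].
      by move=> e1 e2; apply/esym/q_inj.
    move=> _ e1 e2; have := q_lt c; rewrite e1 e2 => /ltn_trans /(_ (q_lt b)).
    by rewrite ltnn.
  have m2 : (mon (icons (q c).2 (cidx e.+1 (q c).1)) == mon (idx b)) =
            (e == 0%N) && (b == c).
    apply/eqP/andP => [/mon_icons_cidx[]|[/eqP e0 /eqP <-]].
    - exact: q_neq.
    - by rewrite eq_sym q_neq.
    - move=> [e1 e2]; have := q_lt c; rewrite e1 e2 => /ltn_trans /(_ (q_lt b)).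
      by rewrite ltnn.
    - by move=> [e0 e1 e2]; rewrite e0; split=> //; apply/eqP/q_inj.
    by rewrite /idx !mon_icons !mon_cidx e0 !mulm1n addmC.
  rewrite m1 m2; case: (b =P c) => [->|_]; rewrite ?andbF ?mulr0 ?subr0 //=.
  by rewrite andbT mulr1 [a _ * _]mulrC.
apply/row_freeP; exists (diag_mx (\row_b (D 0 b)^-1)).
rewrite mulmx_diag -diag_const_mx; congr diag_mx; apply/rowP => b.
have DE c : (\row_b (D 0 b)^-1) 0 c = (D 0 c)^-1 by rewrite mxE.
rewrite [LHS]mxE [RHS]mxE DE.
by rewrite divff.
Qed.

End GenericDim.

End SingularDimension.

(** * Newton iteration in complex space *)

Section Newton.
Variable R : realType.
Local Notation C := R[i].
Implicit Types (z : C) (r eps : R).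

(** The sum norm of the real and imaginary parts. Unlike the modulus on [R[i]] it takes values in
    [R], and it is still submultiplicative. *)
Definition nc z : R := `|complex.Re z| + `|complex.Im z|.

Lemma nc_ge0 z : 0 <= nc z.
Proof. exact: addr_ge0. Qed.

Lemma nc0 : nc 0 = 0.
Proof. by rewrite /nc /= !normr0 addr0. Qed.

Lemma nc_eq0 z : (nc z == 0) = (z == 0).
Proof.
by case: z => a b; rewrite /nc /= paddr_eq0 // !normr_eq0 eq_complex.
Qed.

Lemma ncN z : nc (- z) = nc z.
Proof. by case: z => a b; rewrite /nc /= !normrN. Qed.

Lemma ncD z1 z2 : nc (z1 + z2) <= nc z1 + nc z2.
Proof.
case: z1 z2 => [a b] [c d]; rewrite /nc /=.
by rewrite addrACA lerD // ler_normD.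
Qed.

Lemma ncB z1 z2 : nc (z1 - z2) = nc (z2 - z1).
Proof. by rewrite -ncN opprB. Qed.

Lemma ncM z1 z2 : nc (z1 * z2) <= nc z1 * nc z2.
Proof.
case: z1 z2 => [a b] [c d]; rewrite /nc /=.
apply: (@le_trans _ _ (`|a * c| + `|b * d| + (`|a * d| + `|b * c|))).
  by rewrite lerD // (le_trans (ler_normD _ _)) ?normrN.
by rewrite !normrM; lra.
Qed.

Lemma half_pow_gt0 k : 0 < (2^-1 : R) ^+ k.
Proof. by rewrite exprn_gt0 // invr_gt0. Qed.

Lemma half_pow_small (c eps : R) : 0 < eps -> exists k, c * 2^-1 ^+ k < eps.
Proof.
move=> e0; have [k ck] : exists k : nat, c / eps < k%:R.
  have := archi_boundP (normr_ge0 (c / eps)); set k := Num.bound _ => h.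
  by exists k; apply: le_lt_trans h; apply: ler_norm.
exists k; rewrite exprVn ltr_pdivrMr ?exprn_gt0 //.
have k2 : k%:R <= 2 ^+ k :> R by rewrite -natrX ler_nat ltnW // ltn_expl.
by rewrite mulrC -ltr_pdivrMr //; apply: lt_le_trans ck k2.
Qed.

(** The intervals of radius h k = 2 c / 2^k around u k are nested, since h k - h (k + 1) is exactly
    the allowed step c / 2^k. The limit is the supremum of their left ends. *)
Lemma geometric_limit (u : nat -> R) (c : R) :
    (forall k, `|u k.+1 - u k| <= c * 2^-1 ^+ k) ->
  exists l, forall k, `|l - u k| <= 2 * c * 2^-1 ^+ k.
Proof.
move=> uc; pose h k : R := 2 * c * 2^-1 ^+ k.
have hS k : h k.+1 = c * 2^-1 ^+ k by rewrite /h exprS; field.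
have h2 k : h k = 2 * (c * 2^-1 ^+ k) by rewrite /h mulrA.
have lo k m : u k - h k <= u (k + m)%N - h (k + m)%N.
  elim: m => [|m IH]; first by rewrite addn0.
  apply: le_trans IH _; rewrite addnS hS h2.
  by have := uc (k + m)%N; rewrite ler_norml => /andP[? ?]; lra.
have hi k m : u (k + m)%N + h (k + m)%N <= u k + h k.
  elim: m => [|m IH]; first by rewrite addn0.
  apply: le_trans _ IH; rewrite addnS hS h2.
  by have := uc (k + m)%N; rewrite ler_norml => /andP[? ?]; lra.
have h0 k : 0 <= h k.
  rewrite /h mulr_ge0 ?(ltW (half_pow_gt0 _)) // mulr_ge0 //.
  by have := uc 0%N; rewrite expr0 mulr1; apply: le_trans.
have lohi k m : u k - h k <= u m + h m.
  have [km|mk] := leqP k m.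
    have := lo k (m - k)%N; rewrite subnKC // => /le_trans; apply.
    by have := h0 m; lra.
  have := hi m (k - m)%N; rewrite subnKC 1?ltnW //; apply: le_trans.
  by have := h0 k; lra.
pose E : classical_sets.set R := fun x => exists k, x = u k - h k.
have E0 : classical_sets.nonempty E by exists (u 0%N - h 0%N), 0%N.
have Eub m : classical_sets.ubound E (u m + h m) by move=> _ [k ->]; apply: lohi.
exists (sup E) => k.
have s1 : u k - h k <= sup E.
  apply: ub_le_sup; last by exists k.
  by exists (u 0%N + h 0%N); apply: Eub.
have s2 : sup E <= u k + h k by apply: ge_sup.
by rewrite -/(h k) ler_norml; apply/andP; split; lra.
Qed.

Lemma geometric_limitC (u : nat -> C) (c : R) :
    (forall k, nc (u k.+1 - u k) <= c * 2^-1 ^+ k) ->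
  exists l, forall k, nc (l - u k) <= 4 * c * 2^-1 ^+ k.
Proof.
move=> uc.
have [|a Ha] := @geometric_limit (fun k => complex.Re (u k)) c.
  move=> k; apply: le_trans (uc k); rewrite /nc.
  by case: (u k.+1) (u k) => [a b] [a' b'] /=; rewrite lerDl.
have [|b Hb] := @geometric_limit (fun k => complex.Im (u k)) c.
  move=> k; apply: le_trans (uc k); rewrite /nc.
  by case: (u k.+1) (u k) => [a' b] [a'' b'] /=; rewrite lerDr.
exists (a +i* b)%C => k; rewrite /nc.
by have := Ha k; have := Hb k; case: (u k) => [x y] /=; lra.
Qed.

Section Vectors.
Variable I : finType.
Implicit Types (X Y x : I -> C) (f : (I -> C) -> C).

Definition dist X Y : R := \sum_i nc (X i - Y i).

Lemma dist_ge0 X Y : 0 <= dist X Y.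
Proof. by apply: sumr_ge0 => i _; apply: nc_ge0. Qed.

Lemma nc_dist X Y i : nc (X i - Y i) <= dist X Y.
Proof.
rewrite /dist (bigD1 i) //= lerDl.
by apply: sumr_ge0 => j _; apply: nc_ge0.
Qed.

Lemma dist_refl X : dist X X = 0.
Proof. by apply: big1 => i _; rewrite subrr nc0. Qed.

Lemma dist_trans Y X Z : dist X Z <= dist X Y + dist Y Z.
Proof.
rewrite /dist -big_split /=; apply: ler_sum => i _.
by apply: le_trans (ncD _ _); rewrite addrA subrK.
Qed.

Lemma finite_radius (P : I -> R -> Prop) :
    (forall i r r', r' <= r -> P i r -> P i r') ->
    (forall i, exists2 r, 0 < r & P i r) ->
  exists2 r, 0 < r & forall i, P i r.
Proof.
move=> mono H; suff [r r0 Hr] : exists2 r, 0 < r & forall i, i \in enum I -> P i r.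
  by exists r => // i; apply: Hr; rewrite mem_enum.
elim: (enum I) => [|i s [r r0 Hr]]; first by exists 1.
have [q q0 Hq] := H i; exists (Num.min q r); first by rewrite lt_min q0.
move=> j; rewrite inE => /orP[/eqP ->|js].
  by apply: mono Hq; rewrite ge_min lexx.
by apply: mono (Hr j js); rewrite ge_min lexx orbT.
Qed.

(* A single parameter serves both as radius and as inverse Lipschitz constant. *)
Definition lip_at x r f : Prop :=
  forall X Y, dist X x <= r -> dist Y x <= r -> nc (f X - f Y) <= r^-1 * dist X Y.

Definition lip x f : Prop := exists2 r, 0 < r & lip_at x r f.

Lemma lip_at_mono x f r r' : 0 < r' -> r' <= r -> lip_at x r f -> lip_at x r' f.
Proof.
move=> r0' rr' H X Y hX hY; apply: le_trans (H X Y _ _) _.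
- exact: le_trans rr'.
- exact: le_trans rr'.
by apply: ler_wpM2r; [exact: dist_ge0|rewrite lef_pV2 // posrE (lt_le_trans r0')].
Qed.

Lemma lip_intro x f L r : 0 < r ->
    (forall X Y, dist X x <= r -> dist Y x <= r -> nc (f X - f Y) <= L * dist X Y) ->
  lip x f.
Proof.
move=> r0 H; pose M := Num.max L 1; have M0 : 0 < M by rewrite lt_max ltr01 orbT.
exists (Num.min r M^-1); first by rewrite lt_min r0 invr_gt0.
move=> X Y; rewrite !le_min => /andP[hX _] /andP[hY _].
apply: le_trans (H X Y hX hY) _; apply: ler_wpM2r; first exact: dist_ge0.
apply: (@le_trans _ _ M); first by rewrite le_max lexx.
have m0 : 0 < Num.min r M^-1 by rewrite lt_min r0 invr_gt0.
by rewrite -[leLHS]invrK lef_pV2 ?posrE ?invr_gt0 // ge_min lexx orbT.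
Qed.

Lemma lip_const x c : lip x (fun=> c).
Proof.
apply: (@lip_intro x _ 0 1) => // X Y _ _.
by rewrite subrr nc0 mul0r.
Qed.

Lemma lip_coord x i : lip x (fun X => X i).
Proof. by apply: (@lip_intro x _ 1 1) => // X Y _ _; rewrite mul1r nc_dist. Qed.

Lemma lip_at2 x f g : lip x f -> lip x g ->
  exists2 r, 0 < r & lip_at x r f /\ lip_at x r g.
Proof.
move=> [r r0 Hr] [q q0 Hq].
have m0 : 0 < Num.min r q by rewrite lt_min r0.
by exists (Num.min r q) => //; split; [apply: lip_at_mono Hr|apply: lip_at_mono Hq];
  rewrite // ge_min lexx ?orbT.
Qed.

Lemma lipD x f g : lip x f -> lip x g -> lip x (fun X => f X + g X).
Proof.
move=> lf lg; have [r r0 [Hf Hg]] := lip_at2 lf lg.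
apply: (@lip_intro x _ (2 * r^-1) r) => // X Y hX hY.
have := Hf X Y hX hY; have := Hg X Y hX hY.
have -> : f X + g X - (f Y + g Y) = (f X - f Y) + (g X - g Y) by ring.
by have := ncD (f X - f Y) (g X - g Y); lra.
Qed.

Lemma lipM x f g : lip x f -> lip x g -> lip x (fun X => f X * g X).
Proof.
move=> lf lg; have [r r0 [Hf Hg]] := lip_at2 lf lg.
have bound h Y : lip_at x r h -> dist Y x <= r -> nc (h Y) <= nc (h x) + 1.
  move=> Hh hY; have := Hh Y x hY; rewrite dist_refl (ltW r0) => /(_ isT).
  have := ncD (h Y - h x) (h x); rewrite subrK.
  have : r^-1 * dist Y x <= 1 by rewrite mulrC ler_pdivrMr ?mul1r.
  lra.
apply: (@lip_intro x _ ((nc (g x) + 1) * r^-1 + (nc (f x) + 1) * r^-1) r) => // X Y hX hY.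
have -> : f X * g X - f Y * g Y = (f X - f Y) * g X + f Y * (g X - g Y) by ring.
apply: le_trans (ncD _ _) _; rewrite [leRHS]mulrDl; apply: lerD.
  apply: le_trans (ncM _ _) _; rewrite mulrC -[leRHS]mulrA.
  apply: ler_pM; rewrite ?nc_ge0 //; first exact: bound.
  exact: Hf.
apply: le_trans (ncM _ _) _; rewrite -[leRHS]mulrA.
apply: ler_pM; rewrite ?nc_ge0 //; first exact: bound.
exact: Hg.
Qed.

Lemma eq_lip x f g : f =1 g -> lip x f -> lip x g.
Proof. by move=> e [r r0 H]; exists r => // X Y hX hY; rewrite -!e; apply: H. Qed.

Lemma lip_sum (J : Type) (s : seq J) (P : pred J) x (f : J -> (I -> C) -> C) :
  (forall j, lip x (f j)) -> lip x (fun X => \sum_(j <- s | P j) f j X).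
Proof.
move=> H; elim: s => [|j s IH].
  by apply: eq_lip (lip_const x 0) => X; rewrite big_nil.
case Pj: (P j).
  by apply: eq_lip (lipD (H j) IH) => X; rewrite big_cons Pj.
by apply: eq_lip IH => X; rewrite big_cons Pj.
Qed.

Lemma lip_prod (J : Type) (s : seq J) (P : pred J) x (f : J -> (I -> C) -> C) :
  (forall j, lip x (f j)) -> lip x (fun X => \prod_(j <- s | P j) f j X).
Proof.
move=> H; elim: s => [|j s IH].
  by apply: eq_lip (lip_const x 1) => X; rewrite big_nil.
case Pj: (P j).
  by apply: eq_lip (lipM (H j) IH) => X; rewrite big_cons Pj.
by apply: eq_lip IH => X; rewrite big_cons Pj.
Qed.

Lemma lip_nonzero x f : lip x f -> f x != 0 ->
  exists2 r, 0 < r & forall X, dist X x <= r -> f X != 0.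
Proof.
move=> [r r0 H] fx0.
have n0 : 0 < nc (f x) by rewrite lt_def nc_eq0 fx0 nc_ge0.
exists (Num.min r (r * (nc (f x) / 2))).
  by rewrite lt_min r0 mulr_gt0 // divr_gt0.
move=> X; rewrite le_min => /andP[hX hX']; apply/negP => /eqP fX.
have := H X x hX; rewrite dist_refl (ltW r0) fX sub0r ncN => /(_ isT).
suff : r^-1 * dist X x <= nc (f x) / 2 by lra.
by rewrite mulrC ler_pdivrMr // mulrC.
Qed.

(* f X - f Y = X_i - Y_i up to an arbitrarily small multiple of the distance:
   strict differentiability at x, with gradient the i-th unit vector. *)
Definition strict_at x i eta r f : Prop :=
  forall X Y, dist X x <= r -> dist Y x <= r ->
    nc (f X - f Y - (X i - Y i)) <= eta * dist X Y.

Definition strict x i f : Prop :=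
  forall eta, 0 < eta -> exists2 r, 0 < r & strict_at x i eta r f.

Lemma strict_at_mono x i eta f r r' :
  r' <= r -> strict_at x i eta r f -> strict_at x i eta r' f.
Proof. by move=> rr' H X Y hX hY; apply: H; apply: le_trans rr'. Qed.

(** Simplified Newton iteration: u has the identity as derivative at x, so X - (u X + t w X) is a
    contraction near x for small t, and its fixed points are the zeros sought. *)
Lemma newton x (u w : I -> (I -> C) -> C) eps : 0 < eps ->
    (forall i, strict x i (u i)) -> (forall i, lip x (w i)) ->
    (forall i, u i x = 0) ->
  exists2 delta, 0 < delta & forall t, nc t < delta ->
    exists2 X, dist X x <= eps & forall i, u i X + t * w i X = 0.
Proof.
move=> eps0 su lw ux0.
pose m : R := #|I|%:R + 1; have m1 : 1 <= m by rewrite lerDr.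
have m0 : 0 < m by apply: lt_le_trans m1.
have mI : #|I|%:R <= m by rewrite lerDl.
(* In each coordinate, u and t w contribute at most eta times the distance each. Summing over at
   most m coordinates gives the contraction factor 2 m eta = 1/2. *)
pose eta := (4 * m)^-1; have eta0 : 0 < eta by rewrite invr_gt0 mulr_gt0.
have [r1 r10 Hu] : exists2 r, 0 < r & forall i, strict_at x i eta r (u i).
  apply: finite_radius => [i r r'|i]; first exact: strict_at_mono.
  exact: su.
have [r2 r20 Hw] : exists2 r, 0 < r & forall i, 0 < r -> lip_at x r (w i).
  apply: finite_radius => [i r r' rr' H r0'|i].
    by apply: (lip_at_mono r0' rr'); apply: H; apply: lt_le_trans rr'.
  by have [r r0 H] := lw i; exists r.
pose rho := Num.min r1 (Num.min r2 eps).
have rho0 : 0 < rho by rewrite !lt_min r10 r20 eps0.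
have rho1 : rho <= r1 by rewrite ge_min lexx.
have rho2 : rho <= r2 by rewrite !ge_min lexx orbT.
have rhoe : rho <= eps by rewrite !ge_min lexx !orbT.
pose W := \sum_i nc (w i x) + 1.
have W0 : 0 < W.
  by apply: ltr_wpDl => //; apply: sumr_ge0 => i _; apply: nc_ge0.
(* The first bound gives t w the Lipschitz constant eta; the second makes the first step at most rho
   / 4, so that all iterates stay within rho / 2 of x. *)
exists (Num.min (r2 * eta) (rho / (4 * W))).
  by rewrite lt_min mulr_gt0 //= divr_gt0 // mulr_gt0.
move=> t; rewrite lt_min => /andP[t1 t2].
pose Psi X i := X i - (u i X + t * w i X).
have contract X Y : dist X x <= rho -> dist Y x <= rho ->
    dist (Psi X) (Psi Y) <= 2^-1 * dist X Y.
  move=> hX hY.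
  apply: (@le_trans _ _ (\sum_(i : I) (2 * eta * dist X Y))).
    apply: ler_sum => i _.
    have -> : Psi X i - Psi Y i =
      - (u i X - u i Y - (X i - Y i)) + (- t) * (w i X - w i Y).
      by rewrite /Psi; ring.
    apply: le_trans (ncD _ _) _; rewrite ncN.
    have a1 := Hu i X Y (le_trans hX rho1) (le_trans hY rho1).
    have a2 := Hw i r20 X Y (le_trans hX rho2) (le_trans hY rho2).
    have a3 : nc (- t * (w i X - w i Y)) <= eta * dist X Y.
      apply: le_trans (ncM _ _) _; rewrite ncN.
      apply: le_trans (ler_pM _ _ (ltW t1) a2) _; rewrite ?nc_ge0 //.
      by rewrite mulrACA divff ?mul1r ?gt_eqF.
    by lra.
  rewrite sumr_const -[_ *+ _]mulr_natl mulrA ler_wpM2r ?dist_ge0 //.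
  have -> : 2^-1 = m * (2 * eta) by rewrite /eta; field; rewrite gt_eqF.
  by rewrite ler_wpM2r // mulr_ge0 // ltW.
have start : dist (Psi x) x <= rho / 4.
  apply: (@le_trans _ _ (\sum_i nc t * nc (w i x))).
    apply: ler_sum => i _; rewrite /Psi ux0 add0r addrC addKr ncN.
    exact: ncM.
  rewrite -mulr_sumr; apply: (@le_trans _ _ (nc t * W)).
    by rewrite ler_wpM2l ?nc_ge0 // lerDl.
  by move: t2; rewrite ltr_pdivlMr ?mulr_gt0 // => t2; lra.
pose X k := iter k Psi x.
have hk k : 0 < (2^-1 : R) ^+ k by apply: half_pow_gt0.
have XP k : dist (X k) x <= rho / 2 * (1 - 2^-1 ^+ k) /\
            dist (X k.+1) (X k) <= rho / 4 * 2^-1 ^+ k.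
  have half k' : dist (X k') x <= rho / 2 * (1 - 2^-1 ^+ k') -> dist (X k') x <= rho.
    by move=> h; apply: le_trans h _; have := hk k'; nra.
  elim: k => [|k [IH1 IH2]].
    by rewrite dist_refl expr0 subrr mulr0 mulr1; split.
  have H1 : dist (X k.+1) x <= rho / 2 * (1 - 2^-1 ^+ k.+1).
    have := dist_trans (X k) (X k.+1) x; rewrite exprS; lra.
  split=> //; apply: le_trans (contract _ _ (half _ H1) (half _ IH1)) _.
  by rewrite exprS; lra.
have ex i : exists a, forall k, nc (a - X k i) <= 4 * (rho / 4) * 2^-1 ^+ k.
  apply: geometric_limitC => k; apply: le_trans (XP k).2; exact: nc_dist.
have [l Hl] := boolp.choice ex.
have lk k : dist l (X k) <= m * rho * 2^-1 ^+ k.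
  apply: (@le_trans _ _ (\sum_(i : I) rho * 2^-1 ^+ k)).
    by apply: ler_sum => i _; apply: le_trans (Hl i k) _; lra.
  rewrite sumr_const -[_ *+ _]mulr_natl -mulrA ler_wpM2r //.
  by rewrite mulr_ge0 // ltW.
have Xrho k : dist (X k) x <= rho / 2.
  by apply: le_trans (XP k).1 _; have := hk k; nra.
have lx : dist l x <= rho.
  have [k hk'] := half_pow_small (m * rho) (divr_gt0 rho0 (ltr0n _ 2)).
  have := dist_trans (X k) l x; have := Xrho k; have := lk k; lra.
exists l; first exact: le_trans rhoe.
move=> i; apply/eqP; rewrite -nc_eq0 eq_le nc_ge0 andbT leNgt; apply/negP => pos.
have [k hk'] := half_pow_small (2 * m * rho) pos.
have : nc (u i l + t * w i l) <= 2 * m * rho * 2^-1 ^+ k.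
  have -> : u i l + t * w i l = (l i - X k.+1 i) + (Psi (X k) i - Psi l i).
    rewrite -[X k.+1 i]/(Psi (X k) i).
    have -> : Psi l i = l i - (u i l + t * w i l) by [].
    ring.
  apply: le_trans (ncD _ _) _.
  have b1 := le_trans (nc_dist l (X k.+1) i) (lk k.+1).
  have b2 := nc_dist (Psi (X k)) (Psi l) i.
  have b3 : dist (Psi (X k)) (Psi l) <= 2^-1 * dist (X k) l.
    by apply: contract => //; have := Xrho k; lra.
  have b4 : dist (X k) l = dist l (X k) by apply: eq_bigr => j _; rewrite ncB.
  have := lk k; have := hk k; move: b1; rewrite exprS.
  have : 0 < m * rho * 2^-1 ^+ k by rewrite !mulr_gt0.
  by lra.
lra.
Qed.

End Vectors.
End Newton.

(** * Perturbation of eigenvectors of Fermat forms *)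

Section FermatPerturbation.
Variable R : realType.
Local Notation C := R[i].

(** The error for k + 1 is X times the error for k, plus multiples of X - Y by k x^(k-1) (X - x) and
    Y^k - x^k, both small near x. *)
Lemma pow_strict (x : C) k (eta : R) : 0 < eta ->
  exists2 r, 0 < r & forall X Y, nc (X - x) <= r -> nc (Y - x) <= r ->
    nc (X ^+ k - Y ^+ k - k%:R * x ^+ k.-1 * (X - Y)) <= eta * nc (X - Y).
Proof.
elim: k eta => [|k IH] eta eta0.
  exists 1 => // X Y _ _; rewrite !expr0 subrr sub0r mul0r mul0r oppr0 nc0.
  by rewrite mulr_ge0 ?nc_ge0 // ltW.
pose b := nc x + 1; have b1 : 1 <= b by rewrite lerDr nc_ge0.
have b0 : 0 < b by apply: lt_le_trans b1.
pose K := nc (k%:R * x ^+ k.-1); have K0 : 0 <= K by apply: nc_ge0.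
(* One half of eta is spent on the error for k, multiplied by X with norm at most b. The radius q
   below spends the other half, by K q + (1 + K) q = eta / 2; the bound 1 on eta1 yields the
   Lipschitz constant 1 + K of the k-th power. *)
pose eta1 := Num.min 1 (eta / (2 * b)).
have eta10 : 0 < eta1 by rewrite lt_min ltr01 divr_gt0 // mulr_gt0.
have [r r0 H] := IH _ eta10.
pose q := eta / (2 * (2 * K + 1)).
have q0 : 0 < q by rewrite divr_gt0 // mulr_gt0 //; lra.
exists (Num.min r (Num.min 1 q)); first by rewrite !lt_min r0 q0 ltr01.
move=> X Y; rewrite !le_min => /and3P[X1 X2 X3] /and3P[Y1 Y2 Y3].
set D := X - Y.
have -> : X ^+ k.+1 - Y ^+ k.+1 - k.+1%:R * x ^+ k * D =
    X * (X ^+ k - Y ^+ k - k%:R * x ^+ k.-1 * D)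
    + (k%:R * x ^+ k.-1 * (X - x) * D + (Y ^+ k - x ^+ k) * D).
  rewrite /D; case: k {IH K K0 q q0 H X3 Y3} => [|k] /=; first by rewrite !expr0; ring.
  by rewrite !exprS; ring.
have nX : nc X <= b.
  by have := ncD (X - x) x; rewrite subrK /b => h; apply: le_trans h _; lra.
have h1 := H X Y X1 Y1.
have h2 : nc (Y ^+ k - x ^+ k) <= (1 + K) * nc (Y - x).
  have := H Y x Y1; rewrite subrr nc0 (ltW r0) => /(_ isT).
  set Z := _ - _ - _ => hZ.
  have -> : Y ^+ k - x ^+ k = Z + k%:R * x ^+ k.-1 * (Y - x) by rewrite /Z; ring.
  apply: le_trans (ncD _ _) _; have := ncM (k%:R * x ^+ k.-1) (Y - x).
  rewrite -/K; have : eta1 * nc (Y - x) <= 1 * nc (Y - x).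
    by rewrite ler_wpM2r ?nc_ge0 // /eta1 ge_min lexx.
  lra.
have D0 := nc_ge0 D.
have t1 : nc (X * (X ^+ k - Y ^+ k - k%:R * x ^+ k.-1 * D)) <= eta / 2 * nc D.
  apply: le_trans (ncM _ _) _.
  apply: le_trans (ler_pM _ _ nX h1) _; rewrite ?nc_ge0 //.
  rewrite mulrA ler_wpM2r // -ler_pdivlMl //.
  apply: (@le_trans _ _ (eta / (2 * b))); first by rewrite /eta1 ge_min lexx orbT.
  by rewrite le_eqVlt; apply/orP; left; apply/eqP; field; rewrite gt_eqF.
have t2 : nc (k%:R * x ^+ k.-1 * (X - x) * D) <= K * q * nc D.
  apply: le_trans (ncM _ _) _; rewrite ler_wpM2r //.
  by apply: le_trans (ncM _ _) _; rewrite ler_wpM2l.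
have t3 : nc ((Y ^+ k - x ^+ k) * D) <= (1 + K) * q * nc D.
  apply: le_trans (ncM _ _) _; rewrite ler_wpM2r //.
  by apply: le_trans h2 _; rewrite ler_wpM2l // addr_ge0.
have qE : K * q + (1 + K) * q = eta / 2.
  by rewrite /q; field; apply/lt0r_neq0; lra.
apply: le_trans (ncD _ _) _.
have := ncD (k%:R * x ^+ k.-1 * (X - x) * D) ((Y ^+ k - x ^+ k) * D).
have : K * q * nc D + (1 + K) * q * nc D = eta / 2 * nc D by rewrite -qE; ring.
lra.
Qed.

Variables (n d : nat).

Lemma strict_pow (x : 'I_n.+1 -> C) i (al be : C) :
    d%:R * al * x i ^+ d.-1 - be = 1 ->
  strict x i (fun X => al * X i ^+ d - be * X i).
Proof.
move=> e eta eta0; pose M := nc al + 1.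
have M0 : 0 < M by rewrite ltr_wpDl ?nc_ge0.
have [r r0 H] := pow_strict (x i) d (divr_gt0 eta0 M0); exists r => // X Y hX hY.
have -> : al * X i ^+ d - be * X i - (al * Y i ^+ d - be * Y i) - (X i - Y i) =
  al * (X i ^+ d - Y i ^+ d - d%:R * x i ^+ d.-1 * (X i - Y i)).
  by rewrite -[X i - Y i]mul1r -{1}e; ring.
have h := H (X i) (Y i) (le_trans (nc_dist _ _ _) hX) (le_trans (nc_dist _ _ _) hY).
apply: le_trans (ncM _ _) _.
apply: (@le_trans _ _ (M * (eta / M * nc (X i - Y i)))).
  by apply: ler_pM; rewrite ?nc_ge0 // lerDl.
rewrite mulrA [M * _]mulrC divfK ?gt_eqF //.
by rewrite ler_wpM2l ?nc_dist // ltW.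
Qed.

Lemma lip_pairing_pow (x : 'I_n.+1 -> C) (G : tensor C n d) :
  lip x (fun X => pairing G (pow_tensor d (\row_i X i))).
Proof.
apply: lip_sum => i; apply: lipM; first exact: lip_const.
apply: (@eq_lip _ _ _ (fun X => \prod_k X (i k))).
  by move=> X; rewrite ffunE; apply: eq_bigr => k _; rewrite mxE.
by apply: lip_prod => k; apply: lip_coord.
Qed.

Lemma slice_line (A B : tensor C n d.+1) t j :
  slice (A + t *: B) j = slice A j + t *: slice B j.
Proof. by apply/ffunP => r; rewrite !ffunE. Qed.

(** Normalizing X_c = 1 allows the eigenvalue to be read off at c as a_c + t g_c(X), which
    eliminates it. At t = 0 the remaining equations have a diagonal Jacobian with entries [kap i],
    nonzero by nondegeneracy; division by them makes it the identity, as the iteration requires. *)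
Lemma fermat_perturbation (a x : 'I_n.+1 -> C) c (B : tensor C n d.+1) (eps : R) :
    0 < eps -> x c = 1 -> (forall i, a i * x i ^+ d = a c * x i) ->
    (forall i, i != c -> d%:R * a i * x i ^+ d.-1 != a c) ->
  exists2 delta, 0 < delta & forall t, nc t < delta ->
    exists X, [/\ dist X x <= eps, X c = 1
      & eigen_eqs (fermat d.+1 a + t *: B) (\row_i X i)].
Proof.
move=> eps0 xc ax nd.
pose kap i := d%:R * a i * x i ^+ d.-1 - a c.
pose g i X := pairing (slice B i) (pow_tensor d (\row_i X i)).
pose u i (X : 'I_n.+1 -> C) :=
  if i == c then X i - 1 else (kap i)^-1 * a i * X i ^+ d - (kap i)^-1 * a c * X i.
pose w i (X : 'I_n.+1 -> C) :=
  if i == c then 0 else (kap i)^-1 * (g i X - g c X * X i).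
have kap0 i : i != c -> kap i != 0 by move=> ic; rewrite subr_eq0 nd.
have [i|i|i|delta d0 H] := @newton R _ x u w eps eps0.
- rewrite /u; case: (i =P c) => [_|/eqP ic].
    move=> eta eta0; exists 1 => // X Y _ _.
    have -> : X i - 1 - (Y i - 1) - (X i - Y i) = 0 by ring.
    by rewrite nc0 mulr_ge0 ?dist_ge0 // ltW.
  apply: strict_pow; have := kap0 i ic; rewrite /kap => k0; field.
  exact: k0.
- rewrite /w; case: (i =P c) => _; first exact: lip_const.
  apply: lipM; first exact: lip_const.
  apply: (@eq_lip _ _ _ (fun X => g i X + (-1) * (g c X * X i))) => [X|]; first by rewrite mulN1r.
  apply: lipD; first exact: lip_pairing_pow.
  apply: lipM; first exact: lip_const.
  by apply: lipM; [exact: lip_pairing_pow|exact: lip_coord].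
- rewrite /u; case: (i =P c) => [->|_]; first by rewrite xc subrr.
  by rewrite -!mulrA ax subrr.
exists delta => // t /H[X hX eqX]; exists X.
have Xc : X c = 1.
  by have := eqX c; rewrite /u /w eqxx mulr0 addr0 => /subr0_eq.
pose lam := a c + t * g c X.
have key i : a i * X i ^+ d + t * g i X = lam * X i.
  case: (i =P c) => [->|/eqP ic]; first by rewrite Xc expr1n !mulr1.
  have := eqX i; rewrite /u /w (negPf ic) => /(congr1 (fun z => kap i * z)).
  rewrite mulr0 => E; apply/eqP; rewrite -subr_eq0 -E /lam.
  by apply/eqP; field; apply: kap0.
have val i : pairing (slice (fermat d.+1 a + t *: B) i) (pow_tensor d (\row_j X j)) = lam * X i.
  rewrite slice_line pairingDl pairingZl -key pairing_slice_fermat pow_cidx mxE //.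
split=> // i j; rewrite !val !mxE; ring.
Qed.

End FermatPerturbation.

(** * Quantifier elimination and genericity *)

Section Elimination.
Variables (F : numClosedFieldType) (n d : nat) (J : finType).
Local Notation T := (tensor F n d).

Definition tensor_env (A : T) : seq F := [seq A i : F | i <- enum {: midx n d}].

Definition full_env (A : T) (z : J -> F) : seq F :=
  tensor_env A ++ [seq z j | j <- enum J].

Lemma size_tensor_env A : size (tensor_env A) = #|{: midx n d}|.
Proof. by rewrite size_map cardE. Qed.

Lemma polyfun_eval (t : GRing.term F) :
  GRing.rterm t -> polyfun (fun A : T => GRing.eval (tensor_env A) t).
Proof.
elim: t => //= [k _|c _|k _|t IHt u IHu /andP[/IHt ht /IHu hu]|t IHt /IHt ht
  |t IHt k /IHt ht|t IHt u IHu /andP[/IHt ht /IHu hu]|t IHt k /IHt ht].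
- have [kn|kn] := ltnP k #|{: midx n d}|.
    apply: polyfun_ext (polyfun_coord F (enum_val (Ordinal kn))) => A.
    rewrite /tensor_env (nth_map (enum_val (Ordinal kn))) -?cardE //.
    by rewrite [in LHS](enum_val_nth (enum_val (Ordinal kn))).
  apply: polyfun_ext (polyfun_const n d (0 : F)) => A.
  by rewrite nth_default // size_tensor_env.
- exact: polyfun_const.
- exact: polyfun_const.
- exact: polyfunD.
- apply: polyfun_ext (polyfunB (polyfun_const n d 0) ht) => A; exact: sub0r.
- apply: polyfun_ext (polyfunM (polyfun_const n d k%:R) ht) => A; exact: mulr_natl.
- exact: polyfunM.
elim: k => [|k IHk].
  by apply: polyfun_ext (polyfun_const n d 1) => A; rewrite expr0.
by apply: polyfun_ext (polyfunM ht IHk) => A; rewrite exprS.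
Qed.

Lemma genericT : generic (fun _ : T => True).
Proof.
exists (fun=> 1); split=> //; first exact: polyfun_const.
by exists 0; rewrite ?mem0v ?oner_neq0.
Qed.

(** A polynomial equation holds either on all of [Sym] or nowhere on a nonempty open subset, and
    boolean combinations of generically constant truth values are generically constant. *)
Lemma generic_qf_eval (f : GRing.formula F) :
    GRing.qf_form f -> GRing.rformula f ->
  exists b, generic (fun A : T => GRing.qf_eval (tensor_env A) f = b).
Proof.
elim: f => //=.
- by move=> b _ _; exists b; apply: genericW genericT.
- move=> t u _ /andP[/polyfun_eval pt /polyfun_eval pu].
  have [H|H] := boolp.EM (forall A : T, A \in Sym F n d ->
      GRing.eval (tensor_env A) t = GRing.eval (tensor_env A) u).
    by exists true; apply: genericW genericT => A AS _; rewrite H ?eqxx.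
  exists false; exists (fun A => GRing.eval (tensor_env A) t - GRing.eval (tensor_env A) u).
  split; first exact: polyfunB.
    apply: boolp.contrapT => N; apply: H => A AS; apply/eqP/negPn/negP => E; apply: N.
    by exists A => //; rewrite subr_eq0.
  by move=> A AS; rewrite subr_eq0 => /negPf.
- move=> f IHf g IHg /andP[qf qg] /andP[rf rg].
  have [b Hb] := IHf qf rf; have [c Hc] := IHg qg rg; exists (b && c).
  by apply: genericW (genericI Hb Hc) => A AS [-> ->].
- move=> f IHf g IHg /andP[qf qg] /andP[rf rg].
  have [b Hb] := IHf qf rf; have [c Hc] := IHg qg rg; exists (b || c).
  by apply: genericW (genericI Hb Hc) => A AS [-> ->].
- move=> f IHf g IHg /andP[qf qg] /andP[rf rg].
  have [b Hb] := IHf qf rf; have [c Hc] := IHg qg rg; exists (b ==> c).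
  by apply: genericW (genericI Hb Hc) => A AS [-> ->].
move=> f IHf qf rf; have [b Hb] := IHf qf rf; exists (~~ b).
by apply: genericW Hb => A AS ->.
Qed.

Lemma holds_exists (k : nat) (e : seq F) (f : GRing.formula F) :
  GRing.holds e (foldr (fun i g => GRing.Exists i g) f (iota (size e) k)) <->
  exists2 s, size s = k & GRing.holds (e ++ s) f.
Proof.
elim: k e => [|k IH] e /=.
  by split=> [H|[s /size0nil ->]]; rewrite ?cats0 //; exists [::]; rewrite ?cats0.
have setE x : set_nth 0 e (size e) x = rcons e x.
  by rewrite set_nthE ltnn subnn /= cats1.
split=> [[x]|[[|x s] //= [ss] H]].
  rewrite setE -(size_rcons e x) => /IH[s ss H].
  by exists (x :: s); rewrite /= ?ss // -cat_rcons.
exists x; rewrite setE -(size_rcons e x); apply/IH.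
by exists s => //; rewrite cat_rcons.
Qed.

Definition termfun (h : T -> (J -> F) -> F) : Prop :=
  exists2 t, GRing.rterm t & forall A z, GRing.eval (full_env A z) t = h A z.

Lemma termfun_const c : termfun (fun _ _ => c).
Proof. by exists (GRing.Const c). Qed.

Lemma termfun_coord i : termfun (fun A _ => A i : F).
Proof.
exists (GRing.Var _ (enum_rank i)) => // A z /=.
rewrite nth_cat size_tensor_env ltn_ord (nth_map i) ?nth_enum_rank //.
by rewrite -cardE.
Qed.

Lemma termfun_var j : termfun (fun _ z => z j).
Proof.
exists (GRing.Var _ (#|{: midx n d}| + enum_rank j)) => // A z /=.
rewrite nth_cat size_tensor_env ltnNge leq_addr /= addKn (nth_map j) ?nth_enum_rank //.
by rewrite -cardE.
Qed.

Lemma termfunD h k : termfun h -> termfun k -> termfun (fun A z => h A z + k A z).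
Proof.
move=> [t rt Ht] [u ru Hu]; exists (GRing.Add t u); first by rewrite /= rt ru.
by move=> A z /=; rewrite Ht Hu.
Qed.

Lemma termfunM h k : termfun h -> termfun k -> termfun (fun A z => h A z * k A z).
Proof.
move=> [t rt Ht] [u ru Hu]; exists (GRing.Mul t u); first by rewrite /= rt ru.
by move=> A z /=; rewrite Ht Hu.
Qed.

Lemma termfunB h k : termfun h -> termfun k -> termfun (fun A z => h A z - k A z).
Proof.
move=> [t rt Ht] [u ru Hu]; exists (GRing.Add t (GRing.Opp u)); first by rewrite /= rt ru.
by move=> A z /=; rewrite Ht Hu.
Qed.

Lemma eq_termfun h k : (forall A z, h A z = k A z) -> termfun h -> termfun k.
Proof. by move=> e [t rt Ht]; exists t => // A z; rewrite Ht e. Qed.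

Lemma termfun_sum (I : Type) (s : seq I) (P : pred I) (h : I -> T -> (J -> F) -> F) :
  (forall i, termfun (h i)) -> termfun (fun A z => \sum_(i <- s | P i) h i A z).
Proof.
move=> H; elim: s => [|i s IH].
  by apply: eq_termfun (termfun_const 0) => A z; rewrite big_nil.
case Pi: (P i).
  by apply: eq_termfun (termfunD (H i) IH) => A z; rewrite big_cons Pi.
by apply: eq_termfun IH => A z; rewrite big_cons Pi.
Qed.

Lemma termfun_prod (I : Type) (s : seq I) (P : pred I) (h : I -> T -> (J -> F) -> F) :
  (forall i, termfun (h i)) -> termfun (fun A z => \prod_(i <- s | P i) h i A z).
Proof.
move=> H; elim: s => [|i s IH].
  by apply: eq_termfun (termfun_const 1) => A z; rewrite big_nil.
case Pi: (P i).
  by apply: eq_termfun (termfunM (H i) IH) => A z; rewrite big_cons Pi.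
by apply: eq_termfun IH => A z; rewrite big_cons Pi.
Qed.

Definition dense (Q : T -> Prop) : Prop :=
  forall phi, polyfun phi -> (exists2 A, A \in Sym F n d & phi A != 0) ->
  exists A, [/\ A \in Sym F n d, phi A != 0 & Q A].

(* By quantifier elimination the truth value of Q is generically constant. *)
Lemma generic_of_dense (L : finType) (h : L -> T -> (J -> F) -> F) :
    (forall l, termfun (h l)) ->
    dense (fun A => exists z, forall l, h l A z = 0) ->
  generic (fun A => exists z, forall l, h l A z = 0).
Proof.
move=> th dQ; set Q := fun A : T => _.
have th' l : exists u, GRing.rterm u /\
    forall A z, GRing.eval (full_env A z) u = h l A z.
  by have [u ru Hu] := th l; exists u.
have [t Ht] := boolp.choice th'.
pose body := foldr (fun l g => GRing.And (GRing.Equal (t l) (GRing.Const 0)) g)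
  (GRing.Bool true) (enum L).
have bodyP e : GRing.holds e body <-> forall l, GRing.eval e (t l) = 0.
  have : GRing.holds e body <-> forall l, l \in enum L -> GRing.eval e (t l) = 0.
    rewrite /body; elim: (enum L) => [|l s IH] //=.
    split=> [[E /IH H] l'|H]; first by rewrite inE => /orP[/eqP ->|/H].
    by split; [apply/H/mem_head|apply/IH => l' l's; apply: H; rewrite inE l's orbT].
  move=> ->; split=> H l; last by move=> _; apply: H.
  by apply: H; rewrite mem_enum.
have rbody : GRing.rformula body.
  by rewrite /body; elim: (enum L) => //= l s ->; rewrite (Ht l).1.
pose m := #|{: midx n d}|.
pose full := foldr (fun i g => GRing.Exists i g) body (iota m #|J|).
have rfull : GRing.rformula full by rewrite /full; elim: (iota _ _).
have QP A : Q A <-> GRing.holds (tensor_env A) full.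
  have mE : m = size (tensor_env A) by rewrite size_tensor_env.
  rewrite /full mE.
  have HE := holds_exists #|J| (tensor_env A) body.
  split=> [[z Hz]|/HE [s ss /bodyP Hs]].
    apply/HE; exists [seq z j | j <- enum J]; first by rewrite size_map -cardE.
    by apply/bodyP => l; rewrite -/(full_env A z) (Ht l).2.
  exists (fun j => s`_(enum_rank j)) => l; rewrite -(Ht l).2 -[RHS](Hs l).
  congr (GRing.eval (_ ++ _) _); apply: (@eq_from_nth _ 0).
    by rewrite size_map -cardE ss.
  move=> i; rewrite size_map -cardE => iJ.
  by rewrite (nth_map (enum_val (Ordinal iJ))) -?cardE // -(enum_val_nth _ (Ordinal iJ)) enum_valK.
pose qf := GRing.quantifier_elim (@ClosedFieldQE.ex_elim F) full.
have /andP[qqf rqf] : GRing.qf_form qf && GRing.rformula qf.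
  exact: (GRing.quantifier_elim_wf (@ClosedFieldQE.wf_ex_elim F)).
have qfP A : reflect (GRing.holds (tensor_env A) full) (GRing.qf_eval (tensor_env A) qf).
  apply: GRing.quantifier_elim_rformP rfull; first exact: ClosedFieldQE.wf_ex_elim.
  exact: (ClosedFieldQE.holds_ex_elim (@GRing.solve_monicpoly F)).
have [b [phi [pphi exA Hphi]]] := generic_qf_eval qqf rqf.
exists phi; split=> // A AS phiA; apply/QP/qfP; rewrite Hphi //.
(* Density provides a point of this open set where Q holds, so the constant truth value is true. *)
have [B [BS phiB QB]] := dQ _ pphi exA.
by rewrite -(Hphi _ BS phiB); apply/qfP/QP.
Qed.

End Elimination.

(** * From the Fermat form to a dense set of tensors *)

Section Perturb.
Variables (R : realType) (n e : nat).
Local Notation C := R[i].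
Local Notation d := e.+2.

(* With e + 2 the order of the tensors: x is an eigenvector of the Fermat form
   with weights a; the last condition says that it is a nondegenerate one. *)
Definition simple_point (a x : 'I_n.+1 -> C) (c : 'I_n.+1) : Prop :=
  [/\ x c = 1, forall i, a i * x i ^+ e.+1 = a c * x i
    & forall i, i != c -> e.+1%:R * a i * x i ^+ e != a c].

(** On the line from the Fermat form to a point where phi is nonzero, phi has finitely many zeros,
    so arbitrarily small parameters avoid them. The function g carries whatever open condition on
    the eigenvectors has to survive: independence of powers or distinctness of points. *)
Lemma dense_eigenvectors (K : finType) (a : 'I_n.+1 -> C) (x : K -> 'I_n.+1 -> C)
    (c : K -> 'I_n.+1) (g : (K * 'I_n.+1 -> C) -> C) :
    (forall k, simple_point a (x k) (c k)) ->
    lip (fun p => x p.1 p.2) g -> g (fun p => x p.1 p.2) != 0 ->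
  dense (fun A : tensor C n d => exists Y : K * 'I_n.+1 -> C,
    [/\ forall k, eigen_eqs A (\row_i Y (k, i)), forall k, Y (k, c k) = 1
      & g Y != 0]).
Proof.
move=> sx lg g0 phi pphi [A1 A1S phi1].
pose A0 := fermat d a : tensor C n d.
have A0S : A0 \in Sym C n d by apply: fermat_Sym.
have [p Hp] := polyfun_line A0 A1 pphi.
have p0 : p != 0.
  by apply: (@poly_nonzero_at _ _ 1); rewrite Hp scale1r addrC subrK.
have [r r0 Hr] := lip_nonzero lg g0.
(* The distances of the perturbed vectors, one for each element of K, then add up to at most r. *)
pose eps := r / (#|K|%:R + 1).
have eps0 : 0 < eps by rewrite divr_gt0 // ltr_wpDl.
have [delta delta0 Hd] : exists2 delta, 0 < delta & forall k t, nc t < delta ->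
    exists X, [/\ dist X (x k) <= eps, X (c k) = 1
      & eigen_eqs (A0 + t *: (A1 - A0)) (\row_i X i)].
  apply: (finite_radius (P := fun k delta => forall t, nc t < delta -> exists X,
    [/\ dist X (x k) <= eps, X (c k) = 1
      & eigen_eqs (A0 + t *: (A1 - A0)) (\row_i X i)])).
    by move=> k q q' qq' H t tq; apply: H; apply: lt_le_trans qq'.
  move=> k; have [xc ax nd] := sx k.
  exact: fermat_perturbation.
(* The shift to k + 2 keeps every parameter strictly below delta, including k = 0. *)
pose s k : C := (delta / k.+2%:R)%:C%C.
have s_inj : injective s.
  move=> k l /(congr1 (@complex.Re R)) /= /(mulfI (lt0r_neq0 delta0)) /invr_inj /eqP.
  by rewrite eqr_nat => /eqP[].
have [k pk] := poly_nonroot p0 s_inj.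
have ncs : nc (s k) < delta.
  rewrite /nc /= normr0 addr0 ger0_norm ?divr_ge0 ?(ltW delta0) //.
  by rewrite ltr_pdivrMr // ltr_pMr // ltr1n.
have HX k' := Hd k' _ ncs; have [X {}HX] := boolp.choice HX.
exists (A0 + s k *: (A1 - A0)); split; first by rewrite memvD // memvZ // memvB.
  by rewrite -Hp.
exists (fun p => X p.1 p.2); split=> [k'|k'|]; [by have [] := HX k'|by have [] := HX k'|].
apply: Hr; rewrite /dist -(pair_big predT predT (fun k i => nc (X k i - x k i))) /=.
apply: (@le_trans _ _ (\sum_(k : K) eps)).
  by apply: ler_sum => k' _; have [] := HX k'.
rewrite sumr_const -[_ *+ _]mulr_natl /eps mulrCA ger_pMr //.
by rewrite ler_pdivrMr ?mul1r ?lerDl // ltr_wpDl.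
Qed.

(* Independence of the powers of the y k as an existential polynomial condition. *)
Definition dual_family N (y : 'I_N -> 'rV[C]_n.+1) (D : 'I_N -> midx n d -> C) : Prop :=
  forall k l, \sum_i pow_tensor d (y k) i * D l i = (k == l)%:R.

Definition eigenframe N (A : tensor C n d) : Prop :=
  exists y : 'I_N -> 'rV[C]_n.+1,
    (forall k, eigen_eqs A (y k)) /\ exists D, dual_family y D.

Lemma lip_det N (I : finType) (x : I -> C) (M : (I -> C) -> 'M[C]_N) :
  (forall k l, lip x (fun X => M X k l)) -> lip x (fun X => \det (M X)).
Proof.
move=> H; apply: lip_sum => s; apply: lipM; first exact: lip_const.
by apply: lip_prod => i.
Qed.

(** The perturbed powers are paired with the dual family D of the original ones. The determinant of
    this matrix is 1 before perturbation; while it is nonzero, the inverse matrix corrects D to a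
    new dual family. *)
Lemma dense_eigenframe N a (x : 'I_N -> 'I_n.+1 -> C) c :
    (forall k, simple_point a (x k) (c k)) ->
    (exists D, dual_family (fun k => \row_i x k i) D) ->
  dense (eigenframe N).
Proof.
move=> sx [D xD].
pose M (Y : 'I_N * 'I_n.+1 -> C) : 'M[C]_N :=
  \matrix_(k, l) \sum_i pow_tensor d (\row_j Y (k, j)) i * D l i.
move=> phi pphi nzphi.
have [||A [AS phiA [Y [YA _ detY]]]] :=
  @dense_eigenvectors _ a x c (fun Y => \det (M Y)) sx _ _ phi pphi nzphi.
- apply: lip_det => k l.
  apply: (@eq_lip _ _ _ (fun Y : 'I_N * 'I_n.+1 -> C =>
      \sum_(i : midx n d) (\prod_j Y (k, i j)) * D l i)).
    move=> Y; rewrite mxE; apply: eq_bigr => i _; rewrite ffunE; congr (_ * _).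
    by apply: eq_bigr => j _; rewrite mxE.
  apply: lip_sum => i; apply: lipM; last exact: lip_const.
  by apply: lip_prod => j; apply: lip_coord.
- suff -> : M (fun p => x p.1 p.2) = 1%:M by rewrite det1 oner_neq0.
  by apply/matrixP => k l; rewrite !mxE xD.
exists A; split=> //.
exists (fun k => \row_i Y (k, i)); split=> //.
exists (fun l i => \sum_m D m i * invmx (M Y) m l) => k l.
under eq_bigr do rewrite mulr_sumr.
rewrite exchange_big /=.
transitivity ((M Y *m invmx (M Y)) k l).
  rewrite mxE; apply: eq_bigr => m _; rewrite mxE mulr_suml.
  by apply: eq_bigr => i _; rewrite mulrA.
by rewrite mulmxV ?mxE // unitmxE unitfE.
Qed.

Lemma generic_eigenframe N : dense (eigenframe N) -> generic (eigenframe N).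
Proof.
pose J := ('I_N * 'I_n.+1 + 'I_N * midx n d)%type.
pose L := ('I_N * ('I_n.+1 * 'I_n.+1) + 'I_N * 'I_N)%type.
pose yz (z : J -> C) k : 'rV[C]_n.+1 := \row_i z (inl (k, i)).
pose h (l : L) (A : tensor C n d) (z : J -> C) : C :=
  match l with
  | inl (k, (i, j)) =>
      pairing (slice A j) (pow_tensor e.+1 (yz z k)) * z (inl (k, i))
      - pairing (slice A i) (pow_tensor e.+1 (yz z k)) * z (inl (k, j))
  | inr (k, l) =>
      \sum_i (pow_tensor d (yz z k) i * z (inr (l, i))) - (k == l)%:R
  end.
have hE A : (exists z, forall l, h l A z = 0) <-> eigenframe N A.
  split=> [[z Hz]|[y [yA [D yD]]]].
    exists (yz z); split=> [k i j|].
      by have /subr0_eq := Hz (inl (k, (i, j))); rewrite !mxE.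
    by exists (fun l i => z (inr (l, i))) => k l; have /subr0_eq := Hz (inr (k, l)).
  pose z (j : J) := match j with inl (k, i) => y k 0 i | inr (l, i) => D l i end.
  have yzE k : yz z k = y k by apply/rowP => i; rewrite mxE.
  exists z => -[[k [i j]]|[k l]] /=; first by rewrite yzE yA subrr.
  by rewrite yzE yD subrr.
have tpow m k (i : midx n m) :
    termfun (fun (A : tensor C n d) (z : J -> C) => pow_tensor m (yz z k) i : C).
  apply: (@eq_termfun _ _ _ _ (fun A z => \prod_j z (inl (k, i j)))).
    by move=> A z; rewrite ffunE; apply: eq_bigr => j _; rewrite mxE.
  by apply: termfun_prod => j; apply: termfun_var.
have tpair k j : termfun (fun (A : tensor C n d) (z : J -> C) =>
    pairing (slice A j) (pow_tensor e.+1 (yz z k))).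
  apply: termfun_sum => r; apply: termfunM; last exact: tpow.
  apply: (@eq_termfun _ _ _ _ (fun A z => A (icons j r) : C)); last exact: termfun_coord.
  by move=> A z; rewrite ffunE.
move=> dN; apply: (@genericW _ _ _ (fun A => exists z, forall l, h l A z = 0)).
  by move=> A _ /hE.
apply: generic_of_dense.
  move=> [[k [i j]]|[k l]] /=.
    by apply: termfunB; (apply: termfunM; [exact: tpair|exact: termfun_var]).
  apply: termfunB; last exact: termfun_const.
  by apply: termfun_sum => i; apply: termfunM; [exact: tpow|exact: termfun_var].
move=> phi pphi /(dN _ pphi)[A [AS phiA /hE]].
by exists A.
Qed.

End Perturb.

(** * Families of eigenvectors and their powers *)

Section Transfer.
Variables (F : numFieldType) (n e : nat).
Local Notation d := e.+2.

(* No nonzero symmetric tensor of order d + 1 with all its slices in the singular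
   space of A vanishes at all the indices idx; in particular, the space of these
   tensors has dimension at most N. *)
Definition separates N (idx : 'I_N -> midx n d.+1) (A : tensor F n d) : Prop :=
  forall T : tensor F n d.+1, T \in Sym F n d.+1 ->
    (forall k, singular_eqs A (slice T k)) -> (forall l, T (idx l) = 0) -> T = 0.

(** In a basis of the symmetric tensors of order d + 1, separation says that a matrix polynomial in
    A, with one column for each equation or index, has independent rows. *)
Lemma generic_separates N (idx : 'I_N -> midx n d.+1) A0 :
  A0 \in Sym F n d -> separates idx A0 -> generic (separates idx).
Proof.
move=> A0S sep0.
pose V := Sym F n d.+1; pose b := vbasis V.
have bV : basis_of V b by apply: vbasisP.
pose Q := ('I_n.+1 * ('I_n.+1 * 'I_n.+1) + 'I_N)%type.
pose entry (A : tensor F n d) (T : tensor F n d.+1) (q : Q) : F :=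
  match q with
  | inl (k, p) => singular_form A (slice T k) p
  | inr l => T (idx l)
  end.
pose K A : 'M[F]_(\dim V, #|{: Q}|) := \matrix_(i, q) entry A b`_i (enum_val q).
have entry_lin A a T T' q : entry A (a *: T + T') q = a * entry A T q + entry A T' q.
  case: q => [[k p]|l] /=; last by rewrite !ffunE.
  rewrite -singular_form_linear; congr singular_form.
  by apply/ffunP => r; rewrite !ffunE.
have entry0 A q : entry A 0 q = 0.
  by have := entry_lin A (-1) 0 0 q; rewrite scaler0 addr0 mulN1r addNr.
have entry_sum A (v : 'rV_(\dim V)) q :
    entry A (\sum_i v 0 i *: b`_i) q = \sum_i v 0 i * entry A b`_i q.
  elim/big_ind2: _ => [|x T y T' Tx Ty|i _]; first exact: entry0.
    by have := entry_lin A 1 T T' q; rewrite scale1r mul1r Tx Ty.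
  by have := entry_lin A (v 0 i) b`_i 0 q; rewrite addr0 entry0 addr0.
have sepP A : separates idx A <-> row_free (K A).
  split=> [sep|/row_freeP[B KB] T TS TA Ti].
    apply: inj_row_free => v vK; pose T := \sum_i v 0 i *: b`_i.
    have TE q : entry A T q = 0.
      rewrite entry_sum; have /rowP/(_ (enum_rank q)) := vK; rewrite !mxE => vKq.
      rewrite -[RHS]vKq.
      by apply: eq_bigr => i _; rewrite mxE enum_rankK.
    have T0 : T = 0.
      apply: sep => [|k|l]; last exact: TE (inr l).
        by apply: memv_suml => i _; apply/memvZ/vbasis_mem/mem_nth; rewrite size_tuple.
      by apply/singular_eqs_form => p _; apply: (TE (inl (k, p))).
    have /freeP fb := basis_free bV.
    by apply/rowP => i; rewrite mxE; apply: (fb (fun i => v 0 i) T0).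
  pose v := \row_i coord b i T.
  have TE : T = \sum_i v 0 i *: b`_i.
    by rewrite {1}(coord_basis bV TS); apply: eq_bigr => i _; rewrite mxE.
  suff v0 : v = 0 by rewrite TE big1 // => i _; rewrite v0 mxE scale0r.
  suff vK : v *m K A = 0 by rewrite -[v]mulmx1 -KB mulmxA vK mul0mx.
  apply/rowP => q; rewrite [RHS]mxE [LHS]mxE.
  transitivity (entry A T (enum_val q)).
    by rewrite [in RHS]TE entry_sum; apply: eq_bigr => i _; rewrite [K _ _ _]mxE.
  case: (enum_val q) => [[k p]|l] /=; last exact: Ti.
  by rewrite /singular_form TA subrr.
apply: (@genericW _ _ _ (fun A => row_free (K A))) => [A _ /sepP //|].
apply: generic_row_free A0S _; last exact/sepP.
move=> i q; apply: (@polyfun_ext _ _ _ (fun A => entry A b`_i (enum_val q))).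
  by move=> A; rewrite mxE.
case: (enum_val q) => [[k p]|l] /=; last exact: polyfun_const.
exact: polyfun_singular_form.
Qed.

Lemma singular_eqs_pow A (x : 'rV[F]_n.+1) :
  eigen_eqs A x -> singular_eqs A (pow_tensor d x).
Proof.
by move=> Ax i j; rewrite !slice_pow !pairingZr mulrC Ax mulrC.
Qed.

Lemma slice_sum (I : finType) (v : I -> F) (T : I -> tensor F n d.+1) j :
  slice (\sum_k v k *: T k) j = \sum_k v k *: slice (T k) j.
Proof.
apply/ffunP => r; rewrite ffunE !sum_ffunE; apply: eq_bigr => k _.
by rewrite !ffunE.
Qed.

Lemma singular_eqs_sum (A : tensor F n d) (I : finType) (v : I -> F) (T : I -> tensor F n d) :
  (forall k, singular_eqs A (T k)) -> singular_eqs A (\sum_k v k *: T k).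
Proof.
move=> H; apply/singular_eqs_form => p _.
elim/big_ind: _ => [|S S' hS hS'|k _].
- by have := singular_form_linear A (-1) 0 0 p; rewrite scaler0 addr0 mulN1r addNr.
- by have := singular_form_linear A 1 S S' p; rewrite scale1r hS hS' mulr0 addr0.
have := singular_form_linear A (v k) (T k) 0 p; rewrite addr0 => ->.
have -> : singular_form A (T k) p = 0 by rewrite /singular_form H subrr.
by have := singular_form_linear A (-1) 0 0 p; rewrite scaler0 addr0 mulN1r addNr mulr0 add0r.
Qed.

(** More than N vectors have dependent values at the N indices. The corresponding combination of (d
    + 1)-st powers has its slices in the singular space and vanishes at the indices, hence is zero;
    slicing it multiplies the k-th coefficient by a coordinate of y k. *)
Lemma eigenvector_relation N M (idx : 'I_N -> midx n d.+1) (A : tensor F n d)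
    (y : 'I_M -> 'rV[F]_n.+1) :
    separates idx A -> (forall k, eigen_eqs A (y k)) -> (N < M)%N ->
  exists2 v : 'rV[F]_M, v != 0 &
    forall j, \sum_k (v 0 k * y k 0 j) *: pow_tensor d (y k) = 0.
Proof.
move=> sep yA NM.
pose K : 'M[F]_(M, N) := \matrix_(k, l) (pow_tensor d.+1 (y k) (idx l) : F).
have : kermx K != 0.
  rewrite kermx_eq0; apply/negP => /eqP rK.
  by have := rank_leq_col K; rewrite rK leqNgt NM.
case/rowV0Pn => v /sub_kermxP vK v0; exists v => // j.
pose T := \sum_k v 0 k *: pow_tensor d.+1 (y k).
have sT i : slice T i = \sum_k (v 0 k * y k 0 i) *: pow_tensor d (y k).
  rewrite slice_sum; apply: eq_bigr => k _.
  by rewrite slice_pow scalerA.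
have T0 : T = 0.
  apply: sep => [|k|l].
  - by apply: memv_suml => k _; apply/memvZ/pow_Sym.
  - by rewrite sT; apply: singular_eqs_sum => l; apply: singular_eqs_pow.
  rewrite sum_ffunE; have /rowP/(_ l) := vK; rewrite !mxE => vKl; rewrite -[RHS]vKl.
  by apply: eq_bigr => k _; rewrite !mxE ffunE.
by rewrite -sT T0; apply/ffunP => r; rewrite !ffunE.
Qed.

Lemma pow_tensorZ (m : F) (x : 'rV[F]_n.+1) :
  pow_tensor d (m *: x) = m ^+ d *: pow_tensor d x.
Proof.
apply/ffunP => i; rewrite !ffunE; under eq_bigr do rewrite mxE.
by rewrite big_split /= prodr_const card_ord.
Qed.

Lemma pow_tensor_eq0 (x : 'rV[F]_n.+1) : x != 0 -> pow_tensor d x != 0.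
Proof.
move=> x0; have /rV0Pn[c xc] := x0.
apply/eqP => /ffunP/(_ (cidx d c)); rewrite pow_cidx ffunE => /eqP.
by rewrite expf_eq0 (negPf xc) andbF.
Qed.

Section DualFamily.
Variables (N : nat) (y : 'I_N -> 'rV[F]_n.+1) (D : 'I_N -> midx n d -> F).
Hypothesis yD : forall k l, \sum_i pow_tensor d (y k) i * D l i = (k == l)%:R.

Lemma dual_independent (v : 'I_N -> F) :
  \sum_k v k *: pow_tensor d (y k) = 0 -> forall l, v l = 0.
Proof.
move=> H l; transitivity (\sum_i (\sum_k v k *: pow_tensor d (y k)) i * D l i).
  transitivity (\sum_k v k * (k == l)%:R).
    rewrite (bigD1 l) //= eqxx mulr1 big1 ?addr0 // => k /negPf ->; exact: mulr0.
  under eq_bigr => k _ do rewrite -yD mulr_sumr.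
  rewrite exchange_big /=; apply: eq_bigr => i _; rewrite sum_ffunE mulr_suml.
  by apply: eq_bigr => k _; rewrite !ffunE mulrA.
by rewrite H big1 // => i _; rewrite ffunE mul0r.
Qed.

Lemma dual_neq0 k : y k != 0.
Proof.
apply/eqP => yk0; have := yD k k; rewrite eqxx big1 => [/eqP|i _].
  by rewrite eq_sym oner_eq0.
by rewrite yk0 ffunE big_ord_recl mxE !mul0r.
Qed.

Lemma dual_distinct k l (m : F) : y k = m *: y l -> k = l.
Proof.
move=> E; apply/eqP/negPn/negP => kl; have := yD k k; rewrite eqxx E pow_tensorZ.
under eq_bigr => i _ do rewrite ffunE -mulrA.
by rewrite -mulr_sumr yD eq_sym (negPf kl) mulr0 => /eqP; rewrite eq_sym oner_eq0.
Qed.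

(** The relations for j and j0 are combined so that z^d cancels. Independence of the frame then
    gives c_k (y_kj z_j0 - y_kj0 z_j) = 0 for all k, so that any y k with c_k nonzero is
    proportional to z; there is one because c0 z_j0 z^d is nonzero. *)
Lemma eigenvector_in_frame (idx : 'I_N -> midx n d.+1) (A : tensor F n d) z :
    separates idx A -> (forall k, eigen_eqs A (y k)) ->
    z != 0 -> eigen_eqs A z ->
  exists k m, z = m *: y k.
Proof.
move=> sep yA z0 zA.
pose y' (k : 'I_N.+1) := if unlift ord0 k is Some k' then y k' else z.
have y'A k : eigen_eqs A (y' k) by rewrite /y'; case: unliftP.
have [v v0 Hv] := eigenvector_relation sep y'A (ltnSn N).
pose c k := v 0 (lift ord0 k); pose c0 := v 0 ord0.
have {}Hv j : (c0 * z 0 j) *: pow_tensor d z +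
    \sum_k (c k * y k 0 j) *: pow_tensor d (y k) = 0.
  rewrite -[RHS](Hv j) big_ord_recl /y' unlift_none; congr (_ + _).
  by apply: eq_bigr => k _; rewrite liftK.
have c00 : c0 != 0.
  apply: contraNneq v0 => c00; apply/eqP/rowP => k; rewrite mxE.
  case: (unliftP ord0 k) => [k' ->|-> //].
  have /rV0Pn[j yj] := dual_neq0 k'.
  have := Hv j; rewrite c00 mul0r scale0r add0r => /dual_independent/(_ k')/eqP.
  by rewrite mulf_eq0 (negPf yj) orbF => /eqP.
have /rV0Pn[j0 zj0] := z0.
have prop j k : c k * y k 0 j * z 0 j0 = c k * y k 0 j0 * z 0 j.
  apply/eqP; rewrite -subr_eq0; apply/eqP.
  apply: (@dual_independent (fun k => c k * y k 0 j * z 0 j0 - c k * y k 0 j0 * z 0 j)).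
  have H1 := congr1 ( *:%R (z 0 j0)) (Hv j).
  have H2 := congr1 ( *:%R (z 0 j)) (Hv j0).
  rewrite scaler0 scalerDr scalerA in H1; rewrite scaler0 scalerDr scalerA in H2.
  have := congr2 (fun a b => a - b) H1 H2; rewrite subrr => H12.
  rewrite -[RHS]H12.
  rewrite opprD addrACA -scalerBl.
  have -> : z 0 j0 * (c0 * z 0 j) - z 0 j * (c0 * z 0 j0) = 0 by ring.
  rewrite scale0r add0r !scaler_sumr -sumrB; apply: eq_bigr => l _.
  by rewrite !scalerA -scalerBl; congr (_ *: _); ring.
have /existsP[k ck] : [exists k, c k * y k 0 j0 != 0].
  apply: contraT => /existsPn N0; have := Hv j0; rewrite big1 ?addr0 => [/eqP|k _].
    by rewrite scaler_eq0 mulf_eq0 (negPf c00) (negPf zj0) (negPf (pow_tensor_eq0 z0)).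
  by have /negPn/eqP -> := N0 k; rewrite scale0r.
exists k, (z 0 j0 / y k 0 j0).
have := ck; rewrite mulf_eq0 negb_or => /andP[ck0 yk0].
apply/rowP => j; rewrite mxE; apply: (mulfI ck).
by rewrite -prop; field.
Qed.

(** Different points are multiples of different frame vectors, so a relation between the powers of
    the x regroups, with at most one term per frame vector, into a relation between those of the
    frame. *)
Lemma dual_free_powers (xs : seq 'rV[F]_n.+1) :
    (forall x, x \in xs -> x != 0 /\ exists k m, x = m *: y k) ->
    pairwise (@distinct_points F n) xs ->
  free [seq pow_tensor d x | x <- xs].
Proof.
move=> Hxs pw.
apply/(@freeP _ _ _ (map_tuple (@pow_tensor F n d) (in_tuple xs))) => v Hv.
pose x (j : 'I_(size xs)) := tnth (in_tuple xs) j.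
have Hx j : exists k, exists m, x j = m *: y k.
  by have [_] := Hxs (x j) (mem_tnth _ _).
have x0 j : x j != 0 by have [] := Hxs (x j) (mem_tnth _ _).
have kx j : exists km : 'I_N * F, x j = km.2 *: y km.1.
  by have [k [m E]] := Hx j; exists (k, m).
have [km xE] := boolp.choice kx.
have m0 j : (km j).2 != 0.
  by apply: contraNneq (x0 j) => m0; rewrite xE m0 scale0r.
have inj j j' : (km j).1 = (km j').1 -> j = j'.
  move=> E; apply/eqP/negPn/negP => jj'.
  wlog lt : j j' E jj' / (j < j')%N.
    move=> W; have : (j < j')%N || (j' < j)%N by rewrite -neq_ltn.
    by case/orP => h; [exact: W h|apply: W h; rewrite // eq_sym].
  move: pw => /(pairwiseP (0 : 'rV_n.+1)) /(_ j j' (ltn_ord j) (ltn_ord j') lt).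
  rewrite -!(tnth_nth _ (in_tuple xs)) -/(x j) -/(x j').
  apply/negP/free2P => //; exists ((km j).2 / (km j').2).
  by rewrite [RHS]/= [x j']xE [LHS]xE scalerA divfK ?E.
have Hsum : \sum_j v j *: pow_tensor d (x j) = 0.
  rewrite -[RHS]Hv; apply: eq_bigr => j _; congr (_ *: _).
  by rewrite (nth_map (0 : 'rV_n.+1)) // -(tnth_nth _ (in_tuple xs)).
move=> j.
pose w k := \sum_(l | (km l).1 == k) v l * (km l).2 ^+ d.
have w0 k : w k = 0.
  apply: dual_independent; rewrite -[RHS]Hsum.
  rewrite [RHS](partition_big (fun l => (km l).1) predT) //=; apply: eq_bigr => l _.
  rewrite scaler_suml; apply: eq_bigr => j' /eqP <-.
  by rewrite [x j']xE pow_tensorZ scalerA.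
have := w0 (km j).1; rewrite /w (big_pred1 j) => [/eqP|j' /=].
  by rewrite mulf_eq0 expf_eq0 (negPf (m0 j)) andbF orbF => /eqP.
by apply/eqP/eqP => [/inj|->].
Qed.

End DualFamily.

End Transfer.

Section Frames.
Variables (R : realType) (n e : nat).
Local Notation C := R[i].
Local Notation d := e.+2.

Lemma frame_basis N (idx : 'I_N -> midx n d.+1) (A : tensor C n d) :
    A \in Sym C n d -> eigenframe N A -> separates idx A ->
    \dim (singular_space A) = N ->
  independent_eigentensors A /\ eigentensors_basis A.
Proof.
move=> AS [y [yA [D yD]]] sep dimA.
have in_frame z : eigenvector A z -> z != 0 /\ exists k m, z = m *: y k.
  by move=> /(eigenvectorP _ AS)[z0 zA]; split=> //; exact: (eigenvector_in_frame yD sep yA).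
have indep : independent_eigentensors A.
  move=> xs /allP xsA pw; apply: (dual_free_powers yD) pw => x /xsA.
  exact: in_frame.
split=> //; exists [seq y k | k <- enum 'I_N].
have eigA : all (eigenvector A) [seq y k | k <- enum 'I_N].
  apply/allP => _ /mapP[k _ ->]; apply/eigenvectorP => //; split=> //.
  exact: dual_neq0 yD k.
have pw : pairwise (@distinct_points C n) [seq y k | k <- enum 'I_N].
  rewrite pairwise_map; have : uniq (enum 'I_N) by apply: enum_uniq.
  rewrite uniq_pairwise; apply: sub_pairwise => k l /= kl.
  apply/negPn/negP => /(free2P _ (dual_neq0 yD l)) [m /(dual_distinct yD) E].
  by rewrite E eqxx in kl.
split=> //.
  move=> z zA; have [z0 [k [m zE]]] := in_frame z zA.
  apply/hasP; exists (y k); first by apply: map_f; rewrite mem_enum.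
  have m0 : m != 0 by apply: contraNneq z0 => m0; rewrite zE m0 scale0r.
  apply/free2P => //; exists m^-1.
  by rewrite zE scalerA mulVf // scale1r.
rewrite basisEfree indep //= dimA size_map size_map size_enum_ord leqnn andbT.
apply/span_subvP => _ /mapP[x xs ->]; apply: singular_pow => //.
exact: (allP eigA).
Qed.

(** All checks are made at one Fermat form. A right inverse of the coordinate matrix of the
    independent powers supplies the dual family. *)
Lemma generic_basis N (idx : 'I_N -> midx n d.+1) a (x : 'I_N -> 'I_n.+1 -> C) c :
    (forall i, a i != 0) -> (forall i j, i != j -> e = 0%N -> a i != a j) ->
    N = ('C(n + d, d) - 'C(n.+1, 2))%N ->
    (forall k, simple_point e a (x k) (c k)) ->
    (forall v : 'I_N -> C,
      \sum_k v k *: pow_tensor d (\row_i x k i) = 0 -> forall k, v k = 0) ->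
    separates idx (fermat d a) ->
  generic (fun A : tensor C n d => independent_eigentensors A /\ eigentensors_basis A).
Proof.
move=> a0 a_inj NE sx x_free sep.
have dual : exists D, @dual_family R n e N (fun k => \row_i x k i) D.
  pose m := #|{: midx n d}|.
  pose K : 'M[C]_(N, m) :=
    \matrix_(k, i) (pow_tensor d (\row_j x k j : 'rV[C]_n.+1) (enum_val i) : C).
  have /row_freeP[B KB] : row_free K.
    apply: inj_row_free => v vK; apply/rowP => k; rewrite mxE.
    apply: (x_free (fun k => v 0 k)); apply/ffunP => i.
    have /rowP/(_ (enum_rank i)) := vK; rewrite sum_ffunE !mxE => vKi.
    rewrite [RHS]ffunE -[RHS]vKi; apply: eq_bigr => l _.
    by rewrite !mxE enum_rankK !ffunE.
  exists (fun l i => B (enum_rank i) l) => k l.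
  have /matrixP/(_ k l) := KB; rewrite !mxE => <-.
  rewrite (reindex_onto enum_val enum_rank) => [|i _]; last exact: enum_rankK.
  by apply: eq_big => [i|i _]; rewrite ?enum_valK ?eqxx ?mxE.
have g1 := generic_eigenframe (dense_eigenframe sx dual).
have g2 := generic_separates (fermat_Sym d a) sep.
have g3 := generic_dim_singular a0 a_inj.
apply: genericW (genericI (genericI g1 g2) g3) => A AS [[A1 A2] A3].
by apply: (frame_basis AS A1 A2); rewrite A3 -NE.
Qed.

Lemma fermat_separates_eqs a (T : tensor C n d.+1) k i j :
  singular_eqs (fermat d a) (slice T k) ->
  a j * T (icons k (icons i (cidx e.+1 j))) = a i * T (icons k (icons j (cidx e.+1 i))).
Proof. by move=> /fermat_singular_eqs/(_ i j); rewrite !ffunE. Qed.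

End Frames.

Section Quadrics.
Variables (R : realType) (n : nat).
Local Notation C := R[i].

(** The points are the coordinate vectors, the eigenvectors of a diagonal matrix with distinct
    entries. *)
Lemma generic_basis_quadrics :
  generic (fun A : tensor C n 2 => independent_eigentensors A /\ eigentensors_basis A).
Proof.
pose a (i : 'I_n.+1) : C := i.+1%:R.
have a0 i : a i != 0 by rewrite pnatr_eq0.
have a_inj i j : i != j -> a i != a j by rewrite eqr_nat eqSS.
pose x (k i : 'I_n.+1) : C := (i == k)%:R.
have xE k : \row_i x k i = delta_mx 0 k by apply/rowP => i; rewrite !mxE eqxx.
apply: (@generic_basis R n 0 n.+1 (fun k => cidx 3 k) a x id) => //.
- by move=> i j ij _; apply: a_inj.
- rewrite addn2 [in X in (X - _)%N]binS addnC.
  have -> : ('C(n.+1, 1) + 'C(n.+1, 2) - 'C(n.+1, 2) = 'C(n.+1, 1))%N by rewrite addnK.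
  by rewrite bin1.
- move=> k; split=> [|i|i ik]; rewrite /x ?eqxx //.
    by rewrite !expr1; case: eqP => [->|_] //; rewrite !mulr0.
  by rewrite mul1r expr0 mulr1 a_inj.
- move=> v H l; have := congr1 (fun T : tensor C n 2 => T (cidx 2 l)) H.
  rewrite sum_ffunE [RHS]ffunE => <-; rewrite (bigD1 l) //= xE big1 => [|k kl].
    by rewrite ffunE pow_cidx mxE !eqxx expr1n addr0 [RHS]mulr1.
  by rewrite xE ffunE pow_cidx mxE [l == k]eq_sym (negPf kl) andbF expr0n; apply: mulr0.
move=> T /Sym_monP TS TA Tz.
(* For order 2 the equation reads (a_j - a_i) T_kij = 0, leaving only the coordinates T_rrr, which
   are the chosen indices. *)
have z k i j : i != j -> T (icons k (icons i (cidx 1 j))) = 0.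
  move=> ij; have := fermat_separates_eqs i j (TA k).
  rewrite -(TS (icons k (icons i (cidx 1 j))) (icons k (icons j (cidx 1 i)))).
    move/eqP; rewrite -subr_eq0 -mulrBl mulf_eq0 subr_eq0 => /orP[/eqP E|/eqP //].
    by have := a_inj _ _ ij; rewrite E eqxx.
  by rewrite !mon_icons !mon_cidx !mulm1n [(U_(i) + _)%MM]addmC.
apply/ffunP => m; rewrite [RHS]ffunE.
have -> : m = icons (m ord0) (icons (itail m ord0) (cidx 1 (itail (itail m) ord0))).
  rewrite -[LHS]iconsK -[itail m in LHS]iconsK; congr (icons _ (icons _ _)).
  by apply/ffunP => k; rewrite [RHS]ffunE (ord1 k).
set p := m ord0; set q := itail m ord0; set r := itail _ ord0.
have [->|qr] := eqVneq q r; last exact: z.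
have [->|pr] := eqVneq p r.
  rewrite -[RHS](Tz r); apply: TS.
  by rewrite !mon_icons !mon_cidx -!mulmS.
rewrite -[RHS](z r p r pr); apply: TS.
by rewrite !mon_icons addmA [(U_(p) + _)%MM]addmC -addmA.
Qed.

End Quadrics.

(** * Eigenvectors of Fermat forms *)

Section FermatPoints.
Variables (F : numClosedFieldType) (e : nat).
Hypothesis e0 : (0 < e)%N.

(** The roots of X^(e+1) - X: the possible coordinates of an eigenvector with eigenvalue 1 when all
    weights are 1. *)
Lemma fermat_values : exists v : 'I_e.+1 -> F,
  [/\ injective v, v ord0 = 0 & forall k, v k = 0 \/ v k ^+ e = 1].
Proof.
have [r Dp] := closed_field_poly_normal ('X^e - 1 : {poly F}).
rewrite (monicP _) ?monicXnsubC // scale1r in Dp.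
have size_r : size r = e.
  by have := size_XnsubC (1 : F) e0; rewrite Dp size_prod_XsubC => -[].
have uniq_r : uniq r.
  by rewrite -separable_prod_XsubC -Dp separable_Xn_sub_1 // pnatr_eq0 -lt0n.
have root_r z : z \in r -> z ^+ e = 1.
  rewrite -root_prod_XsubC -Dp rootE !hornerE subr_eq0.
  by move/eqP.
have r0 : 0 \notin r.
  apply/negP => /root_r /eqP; rewrite expr0n eqn0Ngt e0 eq_sym.
  by rewrite oner_eq0.
exists (fun k => (0 :: r)`_k); split=> // [k l E|k].
  apply: val_inj; apply/eqP; rewrite -(nth_uniq 0 _ _ (_ : uniq (0 :: r))) /= ?size_r //.
    exact/eqP.
  by rewrite r0.
case: k => [[|k] kl] /=; first by left.
by right; apply/root_r/mem_nth; rewrite size_r.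
Qed.

(* Points of the projective space of dimension n with coordinates in the range
   of v, normalized so that the first nonzero coordinate is 1: either that
   coordinate is the 0-th one, or one recurses on the others. *)
Fixpoint fpoint_type (n : nat) : finType :=
  if n is m.+1 then ({ffun 'I_m.+1 -> 'I_e.+1} + fpoint_type m)%type else unit.

Variable v : 'I_e.+1 -> F.
Hypothesis v_inj : injective v.
Hypothesis v_root : forall k, v k = 0 \/ v k ^+ e = 1.

Fixpoint fpoint (n : nat) : fpoint_type n -> 'I_n.+1 -> F :=
  match n with
  | 0 => fun _ _ => 1
  | m.+1 => fun k i =>
    match k, unlift ord0 i with
    | inl f, Some i' => v (f i')
    | inl _, None => 1
    | inr k', Some i' => fpoint k' i'
    | inr _, None => 0
    end
  end.

Fixpoint fpoint_coord (n : nat) : fpoint_type n -> 'I_n.+1 :=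
  match n with
  | 0 => fun _ => ord0
  | m.+1 => fun k =>
    match k with inl _ => ord0 | inr k' => lift ord0 (fpoint_coord k') end
  end.

Lemma card_fpoint n : #|fpoint_type n.+1| = ((e.+1) ^ n.+1 + #|fpoint_type n|)%N.
Proof. by rewrite card_sum card_ffun !card_ord. Qed.

Lemma card_fpoint_gt0 n : (0 < #|fpoint_type n|)%N.
Proof. by case: n => [|n]; [rewrite /= card_unit|rewrite card_fpoint addn_gt0 expn_gt0]. Qed.

Lemma fpoint_coord1 n (k : fpoint_type n) : fpoint k (fpoint_coord k) = 1.
Proof.
elim: n k => [//|n IH] [f|k] /=; first by rewrite unlift_none.
by rewrite liftK.
Qed.

Lemma fpoint_root n (k : fpoint_type n) i : fpoint k i = 0 \/ fpoint k i ^+ e = 1.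
Proof.
elim: n k i => [|n IH] k i /=; first by right; rewrite expr1n.
case: k => [f|k]; case: unliftP => [i' _|_]; rewrite ?expr1n //; first by right.
by left.
Qed.

Lemma fpoint_inj n (k l : fpoint_type n) m :
  (forall i, fpoint k i = m * fpoint l i) -> k = l.
Proof.
elim: n k l => [[] [] //|n IH] [f|k] [g|l] /= H.
- have := H ord0; rewrite unlift_none mulr1 => m1.
  congr inl; apply/ffunP => i; apply: v_inj.
  by have := H (lift ord0 i); rewrite liftK -m1 mul1r.
- by have /eqP := H ord0; rewrite unlift_none mulr0 oner_eq0.
- have := H ord0; rewrite unlift_none mulr1 => m0.
  have /eqP := H (lift ord0 (fpoint_coord k)).
  by rewrite liftK fpoint_coord1 -m0 mul0r oner_eq0.
congr inr; apply: IH => i.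
by have := H (lift ord0 i); rewrite liftK.
Qed.

End FermatPoints.

Section Count.

(** The induction step of the next count: the two sides are the increments, from m - 1 to m
    variables beyond the first, of the two quantities compared there. *)
Lemma bin_le_exp e m : (0 < e)%N -> (1 < m)%N -> ('C(m + e.+1, m) <= e.+1 ^ m + m)%N.
Proof.
move=> e0; case: m => [|[|m]] // _; elim: m => [|m IH].
  have : (2 * 'C(e.+3, 2) = e.+3 * e.+2)%N.
    by have := mul_bin_diag e.+3 1; rewrite bin1 => <-.
  have -> : (2 + e.+1 = e.+3)%N by lia.
  rewrite expnS expn1; nia.
set M := m.+2 in IH *; rewrite -/(M.+1).
have := mul_bin_diag (M.+1 + e.+1) M; rewrite addSn /= => E.
rewrite -(leq_pmul2l (ltn0Sn M)) -E.
apply: (@leq_trans ((M + e.+1).+1 * (e.+1 ^ M + M))); first by rewrite leq_mul2l IH orbT.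
rewrite expnS; have : (0 < e.+1 ^ M)%N by rewrite expn_gt0.
case: (e.+1 ^ M)%N => // p _.
have : (p <= M * e * p)%N by rewrite leq_pmull // muln_gt0.
lia.
Qed.

(** Induction on n from n = 2. For cubics n = 2 gives the equality 10 = 7 + 3, the exceptional case,
    so their induction starts at n = 3 with 20 < 15 + 6. *)
Lemma card_fpoint_bound e n : (0 < e)%N -> (1 < n)%N -> (n, e) != (2, 1)%N ->
  ('C(n + e.+2, e.+2) < #|fpoint_type e n| + 'C(n.+1, 2))%N.
Proof.
move=> e0 n1 ne.
have step m : (0 < m)%N ->
    ('C(m + e.+2, e.+2) < #|fpoint_type e m| + 'C(m.+1, 2))%N ->
    ('C(m.+1 + e.+2, e.+2) < #|fpoint_type e m.+1| + 'C(m.+2, 2))%N.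
  move=> m0 IH; rewrite card_fpoint [in X in (_ < _ + X)%N]binS bin1.
  rewrite addSn binS; have := @bin_le_exp e m.+1 e0 m0.
  have -> : 'C(m.+1 + e.+1, m.+1) = 'C(m + e.+2, e.+1).
    have -> : (m.+1 + e.+1 = m + e.+2)%N by lia.
    by rewrite -bin_sub; [congr 'C(_, _)|]; lia.
  lia.
have card0 : #|fpoint_type e 0| = 1%N by rewrite /= card_unit.
case: n n1 ne => [|[|n]] // _; elim: n => [|n IH] ne.
  have e2 : (1 < e)%N by case: e e0 ne {step card0} => [|[]].
  rewrite !card_fpoint card0.
  have : (2 * 'C(e.+4, 2) = e.+4 * e.+3)%N.
    by have := mul_bin_diag e.+4 1; rewrite bin1 => <-.
  have -> : 'C(2 + e.+2, e.+2) = 'C(e.+4, 2).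
    by rewrite -bin_sub; [congr 'C(_, _)|]; lia.
  have -> : 'C(3, 2) = 3%N by [].
  rewrite expnS !expn1; nia.
have [/eqP[n0 e1]|ne'] := boolP ((n.+2, e) == (2, 1)%N); last exact/step/IH.
by rewrite n0 e1 !card_fpoint /= card_unit.
Qed.

End Count.

Section Dependent.
Variables (R : realType) (n e : nat).
Local Notation C := R[i].
Local Notation d := e.+2.
Hypothesis e0 : (0 < e)%N.

(** Nondegeneracy holds because (e + 1) x_i^e is 0 or e + 1, never 1 for positive e. *)
Lemma simple_root_point (x : 'I_n.+1 -> C) c :
  x c = 1 -> (forall i, x i = 0 \/ x i ^+ e = 1) -> simple_point e (fun=> 1) x c.
Proof.
move=> xc xr; split=> // [i|i _]; rewrite ?mul1r ?mulr1.
  by rewrite exprS; case: (xr i) => ->; rewrite ?mul0r ?mulr1.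
case: (xr i) => ->; last by rewrite mulr1 pnatr_eq1 eqSS -lt0n.
by rewrite expr0n eqn0Ngt e0 mulr0 eq_sym oner_eq0.
Qed.

(** For each pair of different Fermat points a nonzero 2 x 2 minor is chosen. Nonvanishing of the
    product g of all these minors keeps the perturbed points different, and their powers are too
    many to be independent in the singular space. *)
Lemma not_generic_independent :
    ('C(n + d, d) < #|fpoint_type e n| + 'C(n.+1, 2))%N ->
  ~ generic (@independent_eigentensors C n d).
Proof.
move=> big gi.
have [v [v_inj _ v_root]] := fermat_values C e0.
pose K := fpoint_type e n; pose x (k : K) := fpoint v k.
have minor (p : K * K) : exists q : 'I_n.+1 * 'I_n.+1, p.1 != p.2 ->
    x p.1 q.1 * x p.2 q.2 - x p.1 q.2 * x p.2 q.1 != 0.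
  case: p => k l /=; apply: boolp.contrapT => N.
  have E q : x k q.1 * x l q.2 = x k q.2 * x l q.1.
    apply/subr0_eq/eqP/negPn/negP => nz; apply: N; by exists q.
  apply: N; exists (ord0, ord0); apply: contraNneq => _ /=.
  apply/eqP/(@fpoint_inj C e v v_inj n k l (x k (fpoint_coord l))) => i.
  have := E (i, fpoint_coord l).
  by rewrite /= [x l (fpoint_coord l)]fpoint_coord1 mulr1.
have [q Hq] := boolp.choice minor.
pose g (Y : K * 'I_n.+1 -> C) := \prod_(p : K * K | p.1 != p.2)
  (Y (p.1, (q p).1) * Y (p.2, (q p).2) + (-1) * (Y (p.1, (q p).2) * Y (p.2, (q p).1))).
have sx (k : K) : simple_point e (fun=> 1) (x k) (fpoint_coord k).
  apply: simple_root_point => [|i]; first exact: fpoint_coord1.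
  exact: fpoint_root.
have lg : lip (fun p : K * 'I_n.+1 => x p.1 p.2) g.
  apply: lip_prod => p; apply: lipD; first by apply: lipM; apply: lip_coord.
  apply: lipM; first exact: lip_const.
  by apply: lipM; apply: lip_coord.
have g0 : g (fun p => x p.1 p.2) != 0.
  by apply/prodf_neq0 => p /Hq; rewrite mulN1r.
have ga : generic (fun A : tensor C n d =>
    \dim (singular_space A) = ('C(n + d, d) - 'C(n.+1, 2))%N).
  apply: (@generic_dim_singular _ _ _ (fun=> 1)) => [i|i j _ ez]; first exact: oner_neq0.
  by move: e0; rewrite ez.
have [phi [pphi exA H]] := genericI gi ga.
have [A [AS phiA [Y [YA Yc gY]]]] := dense_eigenvectors sx lg g0 pphi exA.
have [indep dimA] := H A AS phiA.
pose y (k : K) : 'rV[C]_n.+1 := \row_i Y (k, i).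
have y0 k : y k != 0.
  by apply/eqP => /rowP/(_ (fpoint_coord k)); rewrite !mxE Yc => /eqP; rewrite oner_eq0.
have eigA : all (eigenvector A) [seq y k | k <- enum K].
  apply/allP => _ /mapP[k _ ->]; apply/eigenvectorP => //; split; [exact: y0|exact: YA].
have pw : pairwise (@distinct_points C n) [seq y k | k <- enum K].
  rewrite pairwise_map; have : uniq (enum K) by apply: enum_uniq.
  rewrite uniq_pairwise; apply: sub_pairwise => k l /= kl.
  apply/negPn/negP => /(free2P _ (y0 l)) /(proportionalP _ (y0 l)) E.
  move/prodf_neq0: gY => /(_ (k, l) kl) /=; rewrite mulN1r => /negP; apply.
  by have := E (q (k, l)).2 (q (k, l)).1; rewrite !mxE => ->; rewrite subrr.
have free_y := indep _ eigA pw.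
have : (\dim <<[seq pow_tensor d x | x <- [seq y k | k <- enum K]]>> <= \dim (singular_space A))%N.
  apply: dimvS; apply/span_subvP => _ /mapP[z zs ->]; apply: singular_pow => //.
  exact: (allP eigA).
rewrite (eqP free_y) dimA 2!size_map -cardE => le.
(* There is at least one point, so the difference in the dimension formula is positive and its
   subtraction is not truncated. *)
have := leq_trans (card_fpoint_gt0 e n) le; rewrite subn_gt0 => /ltnW YX.
by move: big; rewrite -(subnK YX) ltn_add2r ltnNge le.
Qed.

End Dependent.


(** * Binary forms and ternary cubics *)

Section BinaryForms.
Variables (R : realType) (e : nat).
Local Notation C := R[i].
Local Notation d := e.+2.
Hypothesis e0 : (0 < e)%N.

Definition bidx m (a : nat) : midx 1 m :=
  [ffun k : 'I_m => if (k < a)%N then ord_max else ord0].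

Lemma mon_bidx m a : (a <= m)%N -> mon (bidx m a) (ord_max : 'I_2) = a.
Proof.
move=> am; rewrite monE -sum1_count big_tuple.
rewrite (eq_bigl (fun k : 'I_m => (k < a)%N)) => [|k].
  by rewrite -(big_ord_widen m (fun=> 1%N) am) sum1_card card_ord.
by rewrite tnth_mktuple ffunE; case: ifP.
Qed.

Lemma mdeg_mon n m (i : midx n m) : mdeg (mon i) = m.
Proof.
rewrite /mon mdeg_sum; under eq_bigr do rewrite mdeg1.
by rewrite sum1_card card_ord.
Qed.

Lemma mon_binary m (i j : midx 1 m) :
  mon i (ord_max : 'I_2) = mon j (ord_max : 'I_2) -> mon i = mon j.
Proof.
move=> E; have := mdeg_mon i; rewrite -[RHS](mdeg_mon j) !mdegE !big_ord_recl !big_ord0.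
have -> : lift ord0 ord0 = ord_max :> 'I_2 by apply: val_inj.
rewrite E => /addIn E0; apply/mnmP => -[[|[|k]] ki] //.
  by rewrite (_ : Ordinal ki = ord0) //; apply: val_inj.
by rewrite (_ : Ordinal ki = ord_max) //; apply: val_inj.
Qed.

Lemma pow_bidx m (x : 'rV[C]_2) a : (a <= m)%N ->
  pow_tensor m x (bidx m a) = \prod_(k < m) x 0 (if (k < a)%N then ord_max else ord0).
Proof. by move=> am; rewrite ffunE; apply: eq_bigr => k _; rewrite ffunE. Qed.

(** The points are (0, 1) and the (1, v_k). For independence, the coordinates with x_1-exponent at
    most e form a Vandermonde system for the v_k, and the exponent d then isolates (0, 1). *)
Lemma generic_basis_binary :
  generic (fun A : tensor C 1 d => independent_eigentensors A /\ eigentensors_basis A).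
Proof.
have [v [v_inj _ v_root]] := fermat_values C e0.
pose x (k : 'I_d) (i : 'I_2) : C :=
  if unlift ord0 k is Some k' then if i == ord0 then 1 else v k'
  else (i == ord_max)%:R.
pose c (k : 'I_d) : 'I_2 := if unlift ord0 k is Some _ then ord0 else ord_max.
(* The x_1-exponents 0, ..., e and d + 1 = e + 3. *)
pose idx (l : 'I_d) : midx 1 d.+1 :=
  bidx d.+1 (if unlift ord0 l is Some l' then l' : nat else d.+1).
apply: (@generic_basis R 1 e d idx (fun=> 1) x c).
- by move=> i; apply: oner_neq0.
- by move=> i j _ ez; move: e0; rewrite ez.
- by rewrite binn add1n binSn subn1.
- move=> k; apply: simple_root_point => //; rewrite /x /c.
    by case: unliftP.
  move=> i; case: unliftP => [k' _|_].
    by case: (i == ord0); [right; rewrite expr1n|apply: v_root].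
  by case: (i == ord_max); [right; rewrite expr1n|left].
- move=> w H.
  have Ha a : (a <= d)%N -> (a == d)%:R * w ord0 +
      \sum_(k < e.+1) w (lift ord0 k) * v k ^+ a = 0.
    move=> ad; have := congr1 (fun T : tensor C 1 d => T (bidx d a)) H.
    rewrite sum_ffunE [RHS]ffunE => Hw; rewrite -[RHS]Hw.
    rewrite [RHS]big_ord_recl /=; congr (_ + _).
      rewrite ffunE pow_bidx // mulrC; congr (_ * _).
      have [->|ne] := eqVneq a d.
        by rewrite big1 // => k _; rewrite mxE /x unlift_none ltn_ord eqxx.
      have lt : (a < d)%N by rewrite ltn_neqAle ne.
      rewrite (bigD1 (Ordinal lt)) //= ltnn mxE /x unlift_none.
      by rewrite (_ : (ord0 == ord_max :> 'I_2) = false) // mul0r.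
    apply: eq_bigr => k _; rewrite ffunE pow_bidx //; congr (_ * _).
    transitivity (\prod_(j < d | (j < a)%N) v k).
      by rewrite -(big_ord_widen d (fun=> v k) ad) prodr_const card_ord.
    rewrite big_mkcond; apply: eq_bigr => j _; rewrite mxE /x liftK.
    by case: ltnP.
  have w1 k : w (lift ord0 k) = 0.
    pose V := Vandermonde e.+1 (\row_k v k).
    have Vu : V \in unitmx.
      rewrite unitmxE unitfE det_Vandermonde; apply/prodf_neq0 => i _.
      apply/prodf_neq0 => j ij; rewrite !mxE subr_eq0; apply: contraTneq ij => /v_inj ->.
      by rewrite ltnn.
    have Vw : V *m (\col_k w (lift ord0 k)) = 0.
      apply/colP => a; rewrite !mxE.
      have := Ha a (leqW (ltnW (ltn_ord a))).
      have -> : (a == d :> nat) = false by have := ltn_ord a; lia.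
      rewrite mul0r add0r => Hw.
      rewrite -[RHS]Hw; apply: eq_bigr => l _; rewrite !mxE.
      by rewrite mulrC.
    have := congr1 (mulmx (invmx V)) Vw; rewrite mulKmx // mulmx0 => /colP/(_ k).
    by rewrite !mxE.
  move=> k; case: (unliftP ord0 k) => [k' ->|->]; first exact: w1.
  have := Ha d (leqnn d); rewrite eqxx mul1r big1 ?addr0 // => l _.
  by rewrite w1 mul0r.
move=> T /Sym_monP TS TA Tz.
have tb a i : (a <= d.+1)%N -> mon i (ord_max : 'I_2) = a -> T i = T (bidx d.+1 a).
  by move=> ad E; apply/TS/mon_binary; rewrite mon_bidx.
have small a : (a <= e)%N -> T (bidx d.+1 a) = 0.
  move=> ae; have := Tz (lift ord0 (Ordinal (ae : (a < e.+1)%N))).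
  by rewrite /idx liftK.
have top : T (bidx d.+1 d.+1) = 0 by have := Tz ord0; rewrite /idx unlift_none.
(* The two missing exponents e + 1 and e + 2 are tied to 1 and 2, which are already covered since e
   is positive. *)
have relation (k : 'I_2) : T (bidx d.+1 (k + e.+1)) = T (bidx d.+1 k.+1).
  rewrite -(tb _ (icons k (icons ord0 (cidx e.+1 ord_max)))).
  - rewrite -(tb _ (icons k (icons ord_max (cidx e.+1 ord0)))).
    + by have := fermat_separates_eqs ord0 ord_max (TA k); rewrite !mul1r.
    + by have := ltn_ord k; lia.
    by case: k => [[|[|k]] lk] //; rewrite !mon_icons !mon_cidx !mnmDE !mulmnE !mnm1E.
  - by have := ltn_ord k; lia.
  by case: k => [[|[|k]] lk] //; rewrite !mon_icons !mon_cidx !mnmDE !mulmnE !mnm1E /=; lia.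
have t1 : T (bidx d.+1 e.+1) = 0 by rewrite (relation ord0) small.
have small1 a : (a <= e.+1)%N -> T (bidx d.+1 a) = 0.
  by rewrite leq_eqVlt => /orP[/eqP -> //|]; apply: small.
have t2 : T (bidx d.+1 e.+2) = 0 by rewrite (relation ord_max) small1.
apply/ffunP => i; rewrite [RHS]ffunE.
have ai : (mon i (ord_max : 'I_2) <= d.+1)%N.
  by rewrite -[X in (_ <= X)%N](mdeg_mon i) mdegE (bigD1 ord_max) //= leq_addr.
rewrite (tb _ i ai (erefl _)).
move: (mon i _) ai => a ai.
have [ae|ae] := leqP a e.+1; first exact: small1.
have [-> //|n2] := eqVneq a e.+2.
by have -> : a = e.+3 by lia.
Qed.

End BinaryForms.

Section TernaryCubics.
Variable R : realType.
Local Notation C := R[i].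

Local Notation o0 := (@Ordinal 3 0 isT).
Local Notation o1 := (@Ordinal 3 1 isT).
Local Notation o2 := (@Ordinal 3 2 isT).

Definition quad (p q r s : 'I_3) : midx 2 4 :=
  icons p (icons q (icons r (cidx 1 s))).

Lemma mon_quad p q r s j :
  mon (quad p q r s) j = ((p == j) + ((q == j) + ((r == j) + (s == j))))%N.
Proof. by rewrite !mon_icons mon_cidx !mnmDE mulmnE !mnm1E muln1. Qed.

Lemma ord3P (P : 'I_3 -> Prop) : P o0 -> P o1 -> P o2 -> forall j, P j.
Proof.
move=> P0 P1 P2 [[|[|[|j]]] lj] //.
- by rewrite (_ : Ordinal lj = o0) //; apply: val_inj.
- by rewrite (_ : Ordinal lj = o1) //; apply: val_inj.
by rewrite (_ : Ordinal lj = o2) //; apply: val_inj.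
Qed.

(** The relations T_kijj = T_kjii of the Fermat cubic group the 15 quartic monomials into seven
    classes: one for each fourth power, one for each pair of variables, and one for the multiples of
    x_0 x_1 x_2. The list has one monomial from each class. *)
Definition cubic_idx : seq (midx 2 4) :=
  [:: quad o0 o0 o0 o0; quad o1 o1 o1 o1; quad o2 o2 o2 o2; quad o0 o0 o0 o1;
      quad o0 o0 o0 o2; quad o1 o1 o1 o2; quad o0 o0 o1 o2].

Lemma cubic_separates :
  separates (fun l : 'I_7 => nth (cidx 4 o0) cubic_idx l) (fermat 3 (fun=> 1 : C)).
Proof.
move=> T /Sym_monP TS TA Tz.
have S i j : (forall k, mon i k = mon j k) -> T i = T j by move=> E; apply/TS/mnmP.
have quadE k i j : T (quad k i j j) = T (icons k (icons i (cidx 2 j))).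
  by apply: S => l; rewrite mon_quad !mon_icons mon_cidx !mnmDE !mnm1E; lia.
have E k i j : T (quad k i j j) = T (quad k j i i).
  by rewrite !quadE; have := fermat_separates_eqs i j (TA k); rewrite !mul1r.
have Z l (l7 : (l < 7)%N) := Tz (Ordinal l7).
have z0 := Z 0%N isT; have z1 := Z 1%N isT; have z2 := Z 2%N isT.
have z01 := Z 3%N isT; have z02 := Z 4%N isT; have z12 := Z 5%N isT.
have z012 := Z 6%N isT; rewrite /= in z0 z1 z2 z01 z02 z12 z012.
have Q p q r s p' q' r' s' :
    (forall j, ((p == j) + ((q == j) + ((r == j) + (s == j))) =
      (p' == j) + ((q' == j) + ((r' == j) + (s' == j))))%N) ->
    T (quad p q r s) = T (quad p' q' r' s').
  by move=> H; apply: S => j; rewrite !mon_quad.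
have y01 : T (quad o0 o0 o1 o1) = 0.
  by rewrite E -[RHS]z01; apply: Q; apply: ord3P.
have y10 : T (quad o0 o1 o1 o1) = 0.
  rewrite (Q _ _ _ _ o1 o0 o1 o1); last by apply: ord3P.
  by rewrite E -[RHS]y01; apply: Q; apply: ord3P.
have y02 : T (quad o0 o0 o2 o2) = 0.
  by rewrite E -[RHS]z02; apply: Q; apply: ord3P.
have y20 : T (quad o0 o2 o2 o2) = 0.
  rewrite (Q _ _ _ _ o2 o0 o2 o2); last by apply: ord3P.
  by rewrite E -[RHS]y02; apply: Q; apply: ord3P.
have y12 : T (quad o1 o1 o2 o2) = 0.
  by rewrite E -[RHS]z12; apply: Q; apply: ord3P.
have y21 : T (quad o1 o2 o2 o2) = 0.
  rewrite (Q _ _ _ _ o2 o1 o2 o2); last by apply: ord3P.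
  by rewrite E -[RHS]y12; apply: Q; apply: ord3P.
have y012 : T (quad o0 o1 o1 o2) = 0.
  rewrite (Q _ _ _ _ o2 o0 o1 o1); last by apply: ord3P.
  by rewrite E -[RHS]z012; apply: Q; apply: ord3P.
have y021 : T (quad o0 o1 o2 o2) = 0.
  rewrite (Q _ _ _ _ o1 o0 o2 o2); last by apply: ord3P.
  by rewrite E -[RHS]z012; apply: Q; apply: ord3P.
apply/ffunP => i; rewrite [RHS]ffunE.
have : (mon i o0 + (mon i o1 + mon i o2) = 4)%N.
  rewrite -[RHS](mdeg_mon i) mdegE !big_ord_recl big_ord0 addn0.
  by congr (mon i _ + (mon i _ + mon i _))%N; apply: val_inj.
have fin p q r s : T (quad p q r s) = 0 ->
    mon i o0 = ((p == o0) + ((q == o0) + ((r == o0) + (s == o0))))%N ->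
    mon i o1 = ((p == o1) + ((q == o1) + ((r == o1) + (s == o1))))%N ->
    mon i o2 = ((p == o2) + ((q == o2) + ((r == o2) + (s == o2))))%N -> T i = 0.
  by move=> z h0 h1 h2; rewrite -z; apply: S; apply: ord3P; rewrite mon_quad.
move: fin; move: (mon i o0) (mon i o1) (mon i o2) => a b c fin abc.
have ca : c = (4 - a - b)%N by lia.
have a4 : (a <= 4)%N by lia.
have b4 : (b <= 4 - a)%N by lia.
subst c; clear abc.
case: a b a4 b4 fin => [|[|[|[|[|//]]]]] [|[|[|[|[|//]]]]] //= _ _ fin.
- exact: fin z2 _ _ _.
- exact: fin y21 _ _ _.
- exact: fin y12 _ _ _.
- exact: fin z12 _ _ _.
- exact: fin z1 _ _ _.
- exact: fin y20 _ _ _.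
- exact: fin y021 _ _ _.
- exact: fin y012 _ _ _.
- exact: fin y10 _ _ _.
- exact: fin y02 _ _ _.
- exact: fin z012 _ _ _.
- exact: fin y01 _ _ _.
- exact: fin z02 _ _ _.
- exact: fin z01 _ _ _.
exact: fin z0 _ _ _.
Qed.

(** For e = 1 the coordinates are 0 and 1, so the points are the nonzero 0/1 vectors, listed as the
    binary digits of 1 to 7. *)
Lemma generic_basis_ternary_cubics :
  generic (fun A : tensor C 2 3 => independent_eigentensors A /\ eigentensors_basis A).
Proof.
pose points := [:: [:: true; false; false]; [:: false; true; false];
  [:: true; true; false]; [:: false; false; true]; [:: true; false; true];
  [:: false; true; true]; [:: true; true; true]].
pose bit (k i : nat) : bool := nth false (nth [::] points k) i.
pose x (k : 'I_7) (i : 'I_3) : C := (bit k i)%:R.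
pose c (k : 'I_7) : 'I_3 := if bit k 0 then o0 else if bit k 1 then o1 else o2.
apply: (@generic_basis R 2 1 7 _ (fun=> 1) x c) cubic_separates => //.
- by move=> i; apply: oner_neq0.
- move=> k; apply: simple_root_point => // [|i]; last first.
    by rewrite /x; case: (bit k i); [right; rewrite expr1n|left].
  by case: k => [[|[|[|[|[|[|[|k]]]]]]] lk].
move=> w H.
pose W (k : nat) : C := if insub k is Some k' then w k' else 0.
have WE (k : 'I_7) : w k = W k by rewrite /W valK.
have ev (p q r : 'I_3) :
    \sum_(k < 7) W k * (bit k p && (bit k q && bit k r))%:R = 0.
  have := congr1 (fun T : tensor C 2 3 => T (icons p (icons q (cidx 1 r)))) H.
  rewrite sum_ffunE [RHS]ffunE => Hw; rewrite -[RHS]Hw; apply: eq_bigr => k _.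
  rewrite ffunE -WE; congr (_ * _).
  rewrite ffunE !(prod_icons (fun j => (\row_i x k i) 0 j)) big_ord1 ffunE !mxE /x.
  by case: (bit k p); case: (bit k q); case: (bit k r); rewrite /= ?mul0r ?mul1r.
have sum7 (b : nat -> bool) : \sum_(k < 7) W k * (b k)%:R =
    W 0 * (b 0)%:R + (W 1 * (b 1)%:R + (W 2 * (b 2)%:R + (W 3 * (b 3)%:R +
    (W 4 * (b 4)%:R + (W 5 * (b 5)%:R + W 6 * (b 6)%:R))))).
  by rewrite !big_ord_recl big_ord0 addr0.
(* At a 0/1 vector a monomial is 1 exactly when its variables lie in the support. The system is thus
   triangular for inclusion, and is solved from the full support down to single coordinates. *)
have w6 := ev o0 o1 o2; have w2 := ev o0 o0 o1; have w4 := ev o0 o0 o2.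
have w5 := ev o1 o1 o2; have w0 := ev o0 o0 o0; have w1 := ev o1 o1 o1.
have w3 := ev o2 o2 o2.
rewrite (sum7 (fun k => bit k 0 && (bit k 1 && bit k 2))) /= in w6.
rewrite (sum7 (fun k => bit k 0 && (bit k 0 && bit k 1))) /= in w2.
rewrite (sum7 (fun k => bit k 0 && (bit k 0 && bit k 2))) /= in w4.
rewrite (sum7 (fun k => bit k 1 && (bit k 1 && bit k 2))) /= in w5.
rewrite (sum7 (fun k => bit k 0 && (bit k 0 && bit k 0))) /= in w0.
rewrite (sum7 (fun k => bit k 1 && (bit k 1 && bit k 1))) /= in w1.
rewrite (sum7 (fun k => bit k 2 && (bit k 2 && bit k 2))) /= in w3.
rewrite !(mulr0, mulr1, add0r, addr0) in w6.
rewrite !(mulr0, mulr1, add0r, addr0, w6) in w2 w4 w5.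
rewrite !(mulr0, mulr1, add0r, addr0, w6, w2, w4, w5) in w0 w1 w3.
by move=> k; rewrite WE; case: k => [[|[|[|[|[|[|[|k]]]]]]] lk].
Qed.

End TernaryCubics.

(** Tensors of order 0 have no slices; their polynomials are constant, so all the equations are
    trivial. *)
Lemma singular_refl0 (F : numFieldType) n (A : tensor F n 0) :
  A \in Sym F n 0 -> A \in singular_space A.
Proof.
move=> AS; rewrite memv_cap AS /= memvE; apply/subv_bigcapP => p _.
rewrite -memvE memv_ker.
have const k : mderiv k (poly_of A) = 0.
  rewrite /poly_of raddf_sum /= big1 // => i _.
  by rewrite /mon big_ord0 mderivZ mpolyX0 mderivC scaler0.
rewrite /partial_form !const !mul0r subrr.
by rewrite -(poly_of0 (erefl (0 : tensor F n 0))) ell_poly_of // pairingC linear0.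
Qed.

Theorem proposition5p4 (R : realType) (n d : nat) :
  (forall A : tensor R[i] n d, A \in Sym R[i] n d -> A \in singular_space A)
  /\
  ((1 < d)%N ->
    for_general (fun A : tensor R[i] n d =>
      \dim (singular_space A) = ('C(n + d, d) - 'C(n.+1, 2))%N))
  /\
  ((0 < n)%N -> (1 < d)%N ->
    (for_general (@independent_eigentensors R[i] n d) <->
       [\/ n = 1%N, d = 2%N | n = 2%N /\ d = 3%N])
    /\
    (for_general (@independent_eigentensors R[i] n d) ->
       for_general (@eigentensors_basis R[i] n d))).
Proof.
split; first by case: d => [|d] A AS; [exact: singular_refl0|exact: singular_refl].
case: d => [|[|e]]; do ?by split.
split=> [_|n0 _].
  apply/for_generalP.
  (* Distinct weights are taken for quadrics, where differences of weights must not vanish; weights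
     1 serve in higher order. *)
  apply: (@generic_dim_singular _ _ _ (fun i => if e == 0%N then i.+1%:R else 1)) => [i|i j ij ez].
    by case: ifP; rewrite ?pnatr_eq0 ?oner_neq0.
  by rewrite ez eqxx eqr_nat eqSS.
have basis : [\/ n = 1%N, e.+2 = 2%N | n = 2%N /\ e.+2 = 3%N] ->
    generic (fun A : tensor R[i] n e.+2 =>
      independent_eigentensors A /\ eigentensors_basis A).
  case: e => [_|e]; first exact: generic_basis_quadrics.
  by case=> [->|//|[-> [->]]]; [exact: generic_basis_binary|exact: generic_basis_ternary_cubics].
have indep_case : for_general (@independent_eigentensors R[i] n e.+2) ->
    [\/ n = 1%N, e.+2 = 2%N | n = 2%N /\ e.+2 = 3%N].
  move=> /for_generalP gi.
  have [n1|n1] := eqVneq n 1%N; first by constructor 1.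
  have [e0|e0] := eqVneq e 0%N; first by constructor 2; rewrite e0.
  have [[n2 e1]|ne] := eqVneq (n, e) (2, 1)%N; first by constructor 3; rewrite n2 e1.
  case: (not_generic_independent _ _ gi); first by rewrite lt0n.
  by apply: card_fpoint_bound => //; rewrite ?lt0n // ltn_neqAle eq_sym n1.
split; last first.
  by move=> /indep_case/basis gb; apply/for_generalP; apply: genericW gb => A _ [].
split=> // /basis gb; apply/for_generalP; apply: genericW gb => A _ [].
by [].
Qed.
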